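(* Let $\mu_0=\mathcal N(0,\Sigma_0)$ and $\mu_\star=\mathcal N(0,\Sigma_\star)$ be centered (possibly singular) Gaussian measures on $\mathbb R^d$ such that $\Sigma_0$ and $\Sigma_\star$ commute, and let $P$ be orthogonal with $\Sigma_0=P\operatorname{diag}((\lambda_i^0)_i)P^T$ and $\Sigma_\star=P\operatorname{diag}((\lambda_i^\star)_i)P^T$. Let $(\Sigma_t)_{t\ge0}$ be the solution of $\dot\Sigma_t=-(G_{\Sigma_t}\Sigma_t+\Sigma_tG_{\Sigma_t})$ initialized at $\Sigma_0$, and $\mu_t=\mathcal N(0,\Sigma_t)$. Then $\Sigma_t=P\operatorname{diag}((\lambda_i(t))_i)P^T$, where for every $i$, $\lambda_i(0)=\lambda_i^0$ and for a.e. $t$ $$\frac{d}{dt}\lambda_i(t)=4\lambda_i(t)\left(\frac{\lambda_i^\star}{\sqrt{\lambda_i^\star\lambda_i(t)+\tilde\varepsilon^2}+\tilde\varepsilon}-\frac{\lambda_i(t)}{\sqrt{\lambda_i(t)^2+\tilde\varepsilon^2}+\tilde\varepsilon}\right).$$ Additionally, for all $t\ge0$: (a) if $\lambda_i^\star>0$, then $|\lambda_i(t)-\lambda_i^\star|\le e^{-C_i^at}|\lambda_i^0-\lambda_i^\star|$; (b) if $\lambda_i^\star=0$, then $|\lambda_i(t)-\lambda_i^\star|=\lambda_i(t)\le\dfrac{\lambda_i^0}{1+\lambda_i^0C_i^bt}$, where $$C_i^a=\frac{4\tilde\varepsilon\min(\lambda_i^\star,\lambda_i^0)}{\big(\sqrt{\lambda_i^\star\max(\lambda_i^0,\lambda_i^\star)+\tilde\varepsilon^2}+\tilde\varepsilon\big)\big(\sqrt{\max(\lambda_i^0,\lambda_i^\star)^2+\tilde\varepsilon^2}+\tilde\varepsilon\big)},\qquad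 C_i^b=\frac4{\sqrt{(\lambda_i^0)^2+\tilde\varepsilon^2}+\tilde\varepsilon}.$$ Consequently, $$S_\varepsilon(\mu_t,\mu_\star)\le\sum_{i:\lambda_i^\star>0}L_ie^{-C_i^at}|\lambda_i^0-\lambda_i^\star|+\sum_{i:\lambda_i^\star=0}L_i\frac{\lambda_i^0}{1+\lambda_i^0C_i^bt},\qquad L_i=2\Big(1+\frac{\lambda_i^\star}{\tilde\varepsilon}\Big).$$
   Context: Fix $d\ge1$, $\varepsilon>0$, and set $\tilde\varepsilon=\varepsilon/4$. $\mathcal N(m,\Sigma)$, for $\Sigma$ symmetric positive semidefinite, is the (possibly singular) Gaussian of mean $m$ and covariance $\Sigma$. For $\Sigma$ symmetric positive semidefinite, $$G_\Sigma=2\Sigma\big((\Sigma^2+\tilde\varepsilon^2\mathrm{Id})^{\frac12}+\tilde\varepsilon\mathrm{Id}\big)^{-1}-2\Sigma_\star^{\frac12}\big((\Sigma_\star^{\frac12}\Sigma\Sigma_\star^{\frac12}+\tilde\varepsilon^2\mathrm{Id})^{\frac12}+\tilde\varepsilon\mathrm{Id}\big)^{-1}\Sigma_\star^{\frac12}.$$ Entropic OT: $\mathrm{OT}_\varepsilon(\mu,\nu)=\min_{\pi\in\Pi(\mu,\nu)}\int\|x-y\|^2d\pi+\varepsilon\,\mathrm{KL}(\pi|\mu\otimes\nu)$, where $\Pi(\mu,\nu)$ is the set of couplings and $\mathrm{KL}(\pi|\gamma)=\int\log(d\pi/d\gamma)d\pi$ if $\pi\ll\gamma$ and $+\infty$ otherwise.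 Sinkhorn divergence: $S_\varepsilon(\mu,\nu)=\mathrm{OT}_\varepsilon(\mu,\nu)-\frac12\mathrm{OT}_\varepsilon(\mu,\mu)-\frac12\mathrm{OT}_\varepsilon(\nu,\nu)$. *)

(* Defs.v *)
From HB Require Import structures.
From mathcomp Require Import all_boot all_order all_algebra.
From mathcomp Require Import all_classical all_reals all_analysis.
From mathcomp Require Import measurable_realfun.

Set Implicit Arguments.
Unset Strict Implicit.
Unset Printing Implicit Defensive.
Import Order.TTheory GRing.Theory Num.Theory.
Import numFieldNormedType.Exports.

Local Open Scope classical_set_scope.
Local Open Scope ring_scope.

Section matrices.
Context {R : realType} {d : nat}.
Implicit Types A S T : 'M[R]_d.

Definition psdmx A : Prop :=
  A^T = A /\ forall x : 'cV[R]_d, 0 <= (x^T *m A *m x) 0 0.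

(* The symmetric positive semidefinite square root, which exists and is unique
   when [A] is positive semidefinite; the default value [0] is only taken
   outside of that case. *)
Definition sqrtmx A : 'M[R]_d := xget 0 [set B | psdmx B /\ B *m B = A].

Definition Gmx (eps : R) T S : 'M[R]_d :=
  let te := eps / 4 in
  2 *: (S *m invmx (sqrtmx (S *m S + (te ^+ 2)%:M) + te%:M))
  - 2 *: (sqrtmx T
          *m invmx (sqrtmx (sqrtmx T *m S *m sqrtmx T + (te ^+ 2)%:M) + te%:M)
          *m sqrtmx T).

(* Classical solutions on [0, +oo[ of Sigma' = - (G Sigma + Sigma G) in the cone
   of positive semidefinite matrices (where G is defined). At the endpoint 0
   only continuity is required. *)
Definition is_Gflow (eps : R) T S0 (Sigma : R -> 'M[R]_d) : Prop :=
  [/\ Sigma 0 = S0,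
      {within `[0, +oo[, continuous Sigma},
      forall t : R, 0 <= t -> psdmx (Sigma t)
    & forall t : R, 0 < t ->
        is_derive t (1 : R) Sigma
          (- (Gmx eps T (Sigma t) *m Sigma t + Sigma t *m Gmx eps T (Sigma t)))].

End matrices.

(* R^d with its Borel (= product) sigma-algebra. *)
Notation euclid R d := (d.-tuple (measurableTypeR R)).

Section gaussian.
Context {R : realType}.

Definition cons_vec n (x : measurableTypeR R * euclid R n) : euclid R n.+1 :=
  [tuple of x.1 :: x.2].

Let measurable_cons_vec n : measurable_fun setT (@cons_vec n).
Proof. exact: measurable_cons. Qed.

HB.instance Definition _ n :=
  isMeasurableFun.Build _ _ _ _ (@cons_vec n) (@measurable_cons_vec n).

(* The standard Gaussian N(0, Id): the n-fold product of N(0, 1). *)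
Fixpoint std_gaussian n : probability (euclid R n) R :=
  match n with
  | 0 => dirac ([tuple] : euclid R 0)
  | n'.+1 => distribution (normal_prob 0 1 \x std_gaussian n')%E (@cons_vec n')
  end.

Definition affine_vec d (m : 'cV[R]_d) (A : 'M[R]_d) (x : euclid R d) :
  euclid R d :=
  [tuple m i 0 + \sum_j A i j * tnth x j | i < d].

Let measurable_affine_vec d (m : 'cV[R]_d) (A : 'M[R]_d) :
  measurable_fun setT (affine_vec m A).
Proof.
apply/measurable_fun_tnthP => i.
rewrite [X in measurable_fun _ X](_ : _ =
    fun x => m i 0 + \sum_j A i j * tnth x j); last first.
  by apply/funext => x; rewrite /= tnth_mktuple.
apply: measurable_funD => //; apply: measurable_sum => j.
by apply: measurable_funM => //; exact: measurable_tnth.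
Qed.

HB.instance Definition _ d (m : 'cV[R]_d) (A : 'M[R]_d) :=
  isMeasurableFun.Build _ _ _ _ (affine_vec m A) (measurable_affine_vec m A).

(* N(m, S) for S positive semidefinite, possibly singular: the law of
   m + S^(1/2) Z where Z is a standard Gaussian vector. *)
Definition gaussian d (m : 'cV[R]_d) (S : 'M[R]_d) :
    probability (euclid R d) R :=
  distribution (std_gaussian d) (affine_vec m (sqrtmx S)).

End gaussian.

Section entropic_transport.
Local Open Scope ereal_scope.
Context {R : realType}.

Definition couplings d (T : measurableType d) (mu nu : probability T R) :
    set (probability (T * T)%type R) :=
  [set pi | forall A : set T, measurable A ->
     pi (A `*` setT) = mu A /\ pi (setT `*` A) = nu A].

(* The negative part of log(dp/dq) is p-integrable, so the integral is always
   meaningful in the extended reals. *)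
Definition KL d (T : measurableType d) (p q : probability T R) : \bar R :=
  if `[< p `<< q >] then
    \int[p]_x lne (Radon_Nikodym (charge_of_finite_measure p) q x)
  else +oo.

Definition sqdist d (x y : euclid R d) : R :=
  (\sum_(i < d) (tnth x i - tnth y i) ^+ 2)%R.

Definition OT (eps : R) d (mu nu : probability (euclid R d) R) : \bar R :=
  ereal_inf [set \int[pi]_z (sqdist z.1 z.2)%:E + eps%:E * KL pi (mu \x nu)
            | pi in couplings mu nu].

(* OT is nonnegative, and finite on measures with finite second moments, in
   particular on Gaussians, so that no indeterminate difference occurs there. *)
Definition sinkhorn_div (eps : R) d (mu nu : probability (euclid R d) R) :
    \bar R :=
  OT eps mu nu - (2^-1)%:E * OT eps mu mu - (2^-1)%:E * OT eps nu nu.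

End entropic_transport.

Section rates.
Context {R : realType}.

Definition rate_a (eps l0 ls : R) : R :=
  let te := eps / 4 in
  4 * te * Num.min ls l0
  / ((Num.sqrt (ls * Num.max l0 ls + te ^+ 2) + te)
     * (Num.sqrt (Num.max l0 ls ^+ 2 + te ^+ 2) + te)).

Definition rate_b (eps l0 : R) : R :=
  let te := eps / 4 in 4 / (Num.sqrt (l0 ^+ 2 + te ^+ 2) + te).

Definition lip_const (eps ls : R) : R := 2 * (1 + ls / (eps / 4)).

End rates.

(* Main.v *)
From HB Require Import structures.
Require Import Defs.
From mathcomp Require Import all_boot all_order all_algebra.
From mathcomp Require Import all_classical all_reals all_analysis.
From mathcomp Require Import measurable_realfun sesquilinear spectral complex.
From mathcomp Require Import ring lra.
Set Implicit Arguments.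
Unset Strict Implicit.
Unset Printing Implicit Defensive.
Import Order.TTheory GRing.Theory Num.Theory.
Import numFieldNormedType.Exports.
Local Open Scope classical_set_scope.
Local Open Scope ring_scope.

(* In the eigenbasis [P] the vector field is locally Lipschitz on positive
   semidefinite matrices and preserves diagonal matrices, so by Gronwall's
   inequality the off-diagonal part of [P^T Sigma_t P] stays zero. The
   eigenvalues then solve
   [lam' = - 4 lam (lam - ls) / (sqrt (ls lam + te^2) + sqrt (lam^2 + te^2))],
   so that [lam] stays between [l0] and [ls], and the two rates follow.

   The bound on the Sinkhorn divergence needs neither the closed form of the
   entropic cost nor the existence of optimal plans. With [Z ~ N(0, Id)],
   [mu_t] and [mu_star] are the laws of [A Z] and [B Z], and for all linear
   [S], [T] the cost between the laws of [S Z] and [T Z] is the infimum of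
   [E |S Z - T Z'|^2 + eps KL(p | N(0, Id) x N(0, Id))] over the couplings [p] of
   two copies of [N(0, Id)]: couplings are pushed forward by the
   data-processing inequality and lifted by composing their density with
   [S x T]. Using the same [p] for the three costs in [S_eps] leaves a comparison
   of quadratic forms in the eigenbasis, whence
   [S_eps(mu_t, mu_star) <= sum_i 2 |lam_i(t) - ls_i|]. *)

(** * Square roots of positive semidefinite matrices *)

(** The flow may be singular, and the matrix square root is not Lipschitz near singular matrices.
    The shifts by [te] remove this obstacle: both roots in [Gmx] that depend on the flow are taken
    of matrices bounded below by [te ^+ 2]. Gronwall's inequality only has to compare a matrix with
    its own diagonal part, where lower bounds on roots are read off entrywise.

    The Sinkhorn divergence is the mean of two differences: the cost between [mu_t] and [mu_star]
    minus the self-cost of [mu_t], and the same minus the self-cost of [mu_star]. Two one-sided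
    comparisons therefore suffice. The quadratic forms involve the roots [a], [b] of the
    eigenvalues, and the weights are chosen of order [|a ^+ 2 - b ^+ 2|]: an error of order
    [|a - b|] would only give the square root of the rate when the target eigenvalue is zero. The
    resulting factor 2 is at most [lip_const]. *)

Section psd.
Context {R : realType}.

(** Newton interpolation: a new node is matched by adding a multiple of the polynomial that vanishes
    at the earlier ones. *)
Lemma exists_interpolation_poly (f : R -> R) (s : seq R) :
  exists p : {poly R}, forall x, x \in s -> p.[x] = f x.
Proof.
elim: s => [|x s [p pE]]; first by exists 0 => x; rewrite in_nil.
have [xs|xs] := boolP (x \in s).
  by exists p => y; rewrite inE => /predU1P[->|]; exact: pE.
pose q := \prod_(y <- s) ('X - y%:P).
have qE y : (q.[y] == 0) = (y \in s) by rewrite -rootE root_prod_XsubC.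
exists (p + ((f x - p.[x]) / q.[x]) *: q) => y; rewrite inE hornerD hornerZ.
case/predU1P => [->|ys].
  by rewrite divfK ?subrKC// qE.
have /eqP -> : q.[y] == 0 by rewrite qE.
by rewrite mulr0 addr0 pE.
Qed.

Lemma trmx_horner_mx n (A : 'M[R]_n.+1) (p : {poly R}) :
  (horner_mx A p)^T = horner_mx A^T p.
Proof.
elim/poly_ind: p => [|p c IH]; first by rewrite !rmorph0 trmx0.
rewrite !rmorphD !rmorphM/= !horner_mx_X !horner_mx_C linearD/= tr_scalar_mx.
rewrite [(_ * _)^T]trmx_mul IH; congr (_ + _).
by apply: comm_mx_horner.
Qed.

Lemma psdmx_sqr n (A : 'M[R]_n) : A^T = A -> psdmx (A *m A).
Proof.
move=> At; split; first by rewrite trmx_mul At.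
move=> x; rewrite mulmxA -{1}At -trmx_mul -mulmxA mxE.
by apply: sumr_ge0 => i _; rewrite mxE -expr2 sqr_ge0.
Qed.

Lemma psdmx_eigenvalue_ge0 n (A : 'M[R]_n) (a : R) :
  psdmx A -> eigenvalue A a -> 0 <= a.
Proof.
move=> [_ A0] /eigenvalueP[v vA v0].
have := A0 v^T; rewrite trmxK vA -scalemxAl mxE.
rewrite pmulr_lge0// mxE lt_def; apply/andP; split; last first.
  by apply: sumr_ge0 => i _; rewrite mxE -expr2 sqr_ge0.
apply: contra v0; rewrite psumr_eq0; last first.
  by move=> i _; rewrite mxE -expr2 sqr_ge0.
move=> /allP h; apply/eqP/rowP => i; rewrite mxE.
by have := h i (mem_index_enum _); rewrite mxE -expr2 sqrf_eq0 => /eqP.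
Qed.

(* Over [R[i]] the matrix is unitarily diagonalizable with nonnegative
   eigenvalues. A real polynomial [p] interpolating the fourth root on the
   spectrum yields the square root [p(A)^2], which is positive semidefinite
   because [p(A)] is symmetric. *)
Lemma psdmx_exists_sqrt n (A : 'M[R]_n) : psdmx A ->
  exists B : 'M[R]_n, psdmx B /\ B *m B = A.
Proof.
case: n A => [|n] A Apsd; first by exists A; split=> //; apply/matrixP=> -[].
have [At A0] := Apsd.
pose toC := real_complex R.
pose AC := map_mx toC A.
have AC_real : AC \is a realmx.
  by apply/mxOverP => i j; rewrite mxE; apply/complex_realP; exists (A i j).
have AC_herm : AC \is hermsymmx.
  apply: realsym_hermsym => //; apply/is_hermitianmxP.
  by rewrite expr0 scale1r map_mx_id// map_trmx At.
have /orthomx_spectralP := hermitian_normalmx AC_herm.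
have := hermitian_spectral_diag_real AC_herm.
set U := spectralmx AC; set D := spectral_diag AC => D_real ACE.
have Uu : U \in unitmx by exact: spectral_unit.
have DE i : D 0 i = toC (complex.Re (D 0 i)).
  by have /complex_realP[k ->] := mxOverP D_real 0 i.
have D0 i : 0 <= complex.Re (D 0 i).
  apply: (psdmx_eigenvalue_ge0 Apsd).
  rewrite -(eigenvalue_map toC) [X in eigenvalue _ X](_ : _ = D 0 i) -/AC//.
  (* Eigenvectors are row vectors here, and the rows of [U] are the eigenvectors of [AC]. *)
  apply/eigenvalueP; exists (row i U).
    rewrite ACE rowE !mulmxA mulmxK// -[_ *m diag_mx D]rowE row_diag_mx.
    by rewrite -scalemxAl.
  apply/eqP => /(congr1 (mulmx^~ (invmx U))); rewrite -row_mul mulmxV// mul0mx.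
  by move=> /rowP/(_ i); rewrite !mxE eqxx => /eqP; rewrite oner_eq0.
have [p pE] := exists_interpolation_poly (fun x => Num.sqrt (Num.sqrt x))
  [seq complex.Re (D 0 i) | i <- enum 'I_n.+1].
exists (horner_mx A (p * p)); split.
  by rewrite rmorphM; apply: psdmx_sqr; rewrite trmx_horner_mx At.
set q := p * p.
have -> : horner_mx A q *m horner_mx A q = horner_mx A (q * q).
  exact/esym/rmorphM.
apply: (map_mx_inj (f := toC)).
rewrite map_horner_mx -/AC ACE horner_mx_uconjC// horner_mx_diag.
suff -> : map_mx (horner (map_poly toC (q * q))) D = D by [].
apply/rowP => i; rewrite mxE DE horner_map; congr toC.
rewrite !hornerM pE; last by apply: map_f; rewrite mem_enum.
by rewrite -!expr2 !sqr_sqrtr ?sqrtr_ge0.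
Qed.

(** With [B] a symmetric root of [A], the form at [x] is the squared norm of [B *m x]. *)
Lemma psdmx_quad_eq0 n (A : 'M[R]_n) (x : 'cV[R]_n) :
  psdmx A -> (x^T *m A *m x) 0 0 = 0 -> A *m x = 0.
Proof.
move=> /psdmx_exists_sqrt[B [[Bt _] <-]].
rewrite mulmxA -{1}Bt -trmx_mul -mulmxA mxE => /eqP.
rewrite psumr_eq0; last by move=> i _; rewrite mxE -expr2 sqr_ge0.
move=> /allP h; rewrite -mulmxA [B *m x](_ : _ = 0) ?mulmx0//.
apply/colP => i; have := h i (mem_index_enum _).
by rewrite !mxE -expr2 sqrf_eq0 => /eqP.
Qed.

Lemma psdmx_congr m n (A : 'M[R]_n) (D : 'M[R]_(n, m)) :
  psdmx A -> psdmx (D^T *m A *m D).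
Proof.
move=> [At A0]; split; first by rewrite !trmx_mul trmxK At mulmxA.
by move=> x; rewrite !mulmxA -trmx_mul -(mulmxA _ D); exact: A0.
Qed.

Lemma psdmx_diag_ge0 n (A : 'M[R]_n) i : psdmx A -> 0 <= A i i.
Proof.
move=> [_ /(_ (delta_mx i 0))].
by rewrite trmx_delta -rowE -colE !mxE.
Qed.

Lemma psdmx_tr_ge0 n (A : 'M[R]_n) : psdmx A -> 0 <= \tr A.
Proof. by move=> Apsd; apply: sumr_ge0 => i _; exact: psdmx_diag_ge0. Qed.

(** The trace is the sum of the nonnegative values of the form at the columns of [D]. *)
Lemma psdmx_tr_congr_eq0 m n (A : 'M[R]_n) (D : 'M[R]_(n, m)) :
  psdmx A -> \tr (D^T *m A *m D) = 0 -> A *m D = 0.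
Proof.
move=> Apsd /eqP; rewrite psumr_eq0; last first.
  by move=> i _; apply: psdmx_diag_ge0; exact: psdmx_congr.
move=> /allP h; apply/matrixP => i j; rewrite [RHS]mxE.
have /eqP := h j (mem_index_enum _).
pose e : 'cV[R]_m := delta_mx j 0.
have -> : (D^T *m A *m D) j j = ((D *m e)^T *m A *m (D *m e)) 0 0.
  rewrite trmx_mul trmx_delta !mulmxA -colE -!(mulmxA (delta_mx 0 j)) -rowE.
  by rewrite 2![in RHS]mxE.
move=> /(psdmx_quad_eq0 Apsd)/colP/(_ i); rewrite mulmxA -colE !mxE.
by [].
Qed.

(** The difference [D] solves the Sylvester equation [A *m D + D *m B = 0]. Pairing it with [D]
    gives two nonnegative traces of sum zero, so both [A] and [B] kill [D], and then
    [D *m D = 0]. *)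
Lemma psdmx_sqr_inj n (A B : 'M[R]_n) :
  psdmx A -> psdmx B -> A *m A = B *m B -> A = B.
Proof.
move=> Apsd Bpsd AB; pose D := A - B.
have Dt : D^T = D by rewrite /D linearB /= Apsd.1 Bpsd.1.
have ADDB : A *m D + D *m B = 0.
  by rewrite mulmxBr mulmxBl AB addrA subrK subrr.
have := congr1 (fun M => \tr (D^T *m M)) ADDB.
rewrite mulmxDr mxtraceD mulmx0 mxtrace0 !mulmxA => tr0.
have tr1 : 0 <= \tr (D^T *m A *m D) by exact/psdmx_tr_ge0/psdmx_congr.
have tr2E : \tr (D^T *m D *m B) = \tr (D^T *m B *m D).
  by rewrite mxtrace_mulC mulmxA Dt mxtrace_mulC mulmxA.
have tr2 : 0 <= \tr (D^T *m B *m D) by exact/psdmx_tr_ge0/psdmx_congr.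
rewrite tr2E in tr0.
have AD : A *m D = 0 by apply: psdmx_tr_congr_eq0 => //; lra.
have BD : B *m D = 0 by apply: psdmx_tr_congr_eq0 => //; lra.
have DD : D^T *m 1%:M *m D = 0 by rewrite mulmx1 Dt {1}/D mulmxBl AD BD subrr.
have psd1 : psdmx (1%:M : 'M[R]_n) by rewrite -[1%:M]mulmx1; exact/psdmx_sqr/trmx1.
apply/eqP; rewrite -subr_eq0 -/D -[D]mul1mx; apply/eqP.
by apply: psdmx_tr_congr_eq0 => //; rewrite DD mxtrace0.
Qed.

Lemma sqrtmxP n (A : 'M[R]_n) : psdmx A ->
  psdmx (sqrtmx A) /\ sqrtmx A *m sqrtmx A = A.
Proof.
move=> /psdmx_exists_sqrt[B BA].
by have := xgetPex 0 (ex_intro [set B | psdmx B /\ B *m B = A] B BA).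
Qed.

Lemma sqrtmx_unique n (A B : 'M[R]_n) :
  psdmx B -> B *m B = A -> sqrtmx A = B.
Proof.
move=> Bpsd BA; have Apsd : psdmx A by rewrite -BA; exact: psdmx_sqr Bpsd.1.
have [Spsd SA] := sqrtmxP Apsd.
by apply: psdmx_sqr_inj => //; rewrite SA BA.
Qed.

Lemma psdmx_diag_mx n (a : 'rV[R]_n) :
  (forall i, 0 <= a 0 i) -> psdmx (diag_mx a).
Proof.
move=> a0; split; first exact: tr_diag_mx.
move=> x; rewrite mul_mx_diag mxE; apply: sumr_ge0 => i _.
by rewrite !mxE mulrAC mulr_ge0// -expr2 sqr_ge0.
Qed.

Lemma sqrtmx_conj_diag n (P : 'M[R]_n) (a : 'rV[R]_n) :
  P^T *m P = 1%:M -> (forall i, 0 <= a 0 i) ->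
  sqrtmx (P *m diag_mx a *m P^T) =
  P *m diag_mx (\row_i Num.sqrt (a 0 i)) *m P^T.
Proof.
move=> PtP a0; apply: sqrtmx_unique.
  rewrite -{1}[P]trmxK; apply/psdmx_congr/psdmx_diag_mx => i.
  by rewrite mxE sqrtr_ge0.
rewrite !mulmxA -[_ *m P^T *m P]mulmxA PtP mulmx1.
rewrite -[P *m _ *m diag_mx _]mulmxA mulmx_diag.
congr (_ *m diag_mx _ *m _); apply/rowP => i.
by rewrite !mxE -expr2 sqr_sqrtr.
Qed.

End psd.

(** * The matrix vector field *)

Section frobenius.
Context {R : realType}.

Lemma sum_cauchy_schwarz n (a b : 'I_n -> R) :
  (\sum_i a i * b i) ^+ 2 <= (\sum_i a i ^+ 2) * (\sum_i b i ^+ 2).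
Proof.
have : 0 <= \sum_i \sum_j (a i * b j - a j * b i) ^+ 2.
  by apply: sumr_ge0 => i _; apply: sumr_ge0 => j _; exact: sqr_ge0.
(* Lagrange's identity. *)
suff -> : \sum_i \sum_j (a i * b j - a j * b i) ^+ 2 =
    2 * ((\sum_i a i ^+ 2) * (\sum_i b i ^+ 2) - (\sum_i a i * b i) ^+ 2).
  by rewrite pmulr_rge0// subr_ge0.
transitivity (\sum_i \sum_j (a i ^+ 2 * b j ^+ 2) +
    \sum_i \sum_j (b i ^+ 2 * a j ^+ 2) -
    2 * \sum_i \sum_j (a i * b i * (a j * b j))).
  rewrite mulr_sumr -big_split -sumrB /=; apply: eq_bigr => i _.
  rewrite mulr_sumr -big_split -sumrB /=; apply: eq_bigr => j _; ring.
have sumM (f g : 'I_n -> R) :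
    \sum_i \sum_j f i * g j = (\sum_i f i) * (\sum_j g j).
  by rewrite mulr_suml; apply: eq_bigr => i _; rewrite mulr_sumr.
rewrite !sumM; ring.
Qed.

Definition fro2 m n (A : 'M[R]_(m, n)) : R := \sum_i \sum_j A i j ^+ 2.

Lemma fro2_ge0 m n (A : 'M[R]_(m, n)) : 0 <= fro2 A.
Proof. by apply: sumr_ge0 => i _; apply: sumr_ge0 => j _; exact: sqr_ge0. Qed.

Lemma fro2E m n (A : 'M[R]_(m, n)) : fro2 A = \tr (A^T *m A).
Proof.
rewrite /fro2 exchange_big; apply: eq_bigr => i _.
by rewrite mxE; apply: eq_bigr => j _; rewrite mxE expr2.
Qed.

Lemma fro20 m n : fro2 (0 : 'M[R]_(m, n)) = 0.
Proof. by rewrite fro2E mulmx0 mxtrace0. Qed.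

Lemma fro2Z m n c (A : 'M[R]_(m, n)) : fro2 (c *: A) = c ^+ 2 * fro2 A.
Proof.
rewrite /fro2 mulr_sumr; apply: eq_bigr => i _; rewrite mulr_sumr.
by apply: eq_bigr => j _; rewrite mxE exprMn.
Qed.

Lemma fro2N m n (A : 'M[R]_(m, n)) : fro2 (- A) = fro2 A.
Proof. by rewrite -scaleN1r fro2Z sqrrN expr1n mul1r. Qed.

Lemma le_fro2D m n (A B : 'M[R]_(m, n)) :
  fro2 (A + B) <= 2 * fro2 A + 2 * fro2 B.
Proof.
rewrite !mulr_sumr -big_split; apply: ler_sum => i _ /=.
rewrite !mulr_sumr -big_split; apply: ler_sum => j _ /=.
by rewrite mxE; have := sqr_ge0 (A i j - B i j); nra.
Qed.

Lemma le_fro2M m n p (A : 'M[R]_(m, n)) (B : 'M[R]_(n, p)) :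
  fro2 (A *m B) <= fro2 A * fro2 B.
Proof.
rewrite [fro2 B]exchange_big /= mulr_suml; apply: ler_sum => i _.
by rewrite mulr_sumr; apply: ler_sum => j _; rewrite mxE sum_cauchy_schwarz.
Qed.

Lemma le_fro2_mulB m n p (A A' : 'M[R]_(m, n)) (B B' : 'M[R]_(n, p)) :
  fro2 (A *m B - A' *m B') <=
  2 * (fro2 (A - A') * fro2 B) + 2 * (fro2 A' * fro2 (B - B')).
Proof.
have -> : A *m B - A' *m B' = (A - A') *m B + A' *m (B - B').
  by rewrite mulmxBl mulmxBr addrA subrK.
by apply: le_trans (le_fro2D _ _) _; rewrite lerD// ler_wpM2l// le_fro2M.
Qed.

(** Young's inequality with weight [c], entry by entry; it lets a coercive term [c * fro2 A] absorb
    half of a pairing. *)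
Lemma mxtrace_tr_mul_le n (c : R) (A B : 'M[R]_n) : 0 < c ->
  2 * \tr (A^T *m B) <= c * fro2 A + c^-1 * fro2 B.
Proof.
move=> c0.
have -> : \tr (A^T *m B) = \sum_i \sum_j A j i * B j i.
  by apply: eq_bigr => i _; rewrite mxE; apply: eq_bigr => j _; rewrite mxE.
rewrite exchange_big /= !mulr_sumr -big_split; apply: ler_sum => i _ /=.
rewrite !mulr_sumr -big_split; apply: ler_sum => j _ /=.
have : 0 <= c^-1 * (c * A i j - B i j) ^+ 2.
  by rewrite mulr_ge0 ?sqr_ge0// invr_ge0 ltW.
rewrite (_ : c^-1 * _ ^+ 2 =
  c * A i j ^+ 2 - 2 * (A i j * B i j) + c^-1 * B i j ^+ 2); first lra.
by field; rewrite gt_eqF.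
Qed.

Lemma unitmx_psd_shift n (A : 'M[R]_n) (c : R) : 0 < c -> psdmx A ->
  A + c%:M \in unitmx.
Proof.
move=> c0 Apsd; rewrite -row_free_unit -kermx_eq0; apply/eqP.
set K := kermx _; have KM : K *m (A + c%:M) = 0 by exact: mulmx_ker.
have psd1 : psdmx (1%:M : 'M[R]_n) by rewrite -[1%:M]mulmx1; exact/psdmx_sqr/trmx1.
apply: trmx_inj; rewrite trmx0 -[K^T]mul1mx; apply: psdmx_tr_congr_eq0 => //.
have := congr1 (fun M => \tr (M *m K^T)) KM.
rewrite mulmxDr mulmxDl mxtraceD mul0mx mxtrace0 mul_mx_scalar -scalemxAl.
rewrite mxtraceZ trmxK mulmx1.
have h1 : 0 <= \tr (K *m A *m K^T).
  by rewrite -{1}[K]trmxK; exact/psdmx_tr_ge0/psdmx_congr.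
have h2 : 0 <= \tr (K *m K^T).
  by rewrite -{1}[K]trmxK -fro2E fro2_ge0.
by nra.
Qed.

(** Pairing [(A + c%:M) *m V = 1%:M] with [V] bounds [c * fro2 V] by the trace of [V], which Young's
    inequality absorbs; [n] is the squared norm of the identity. *)
Lemma fro2_inv_psd_shift n (A : 'M[R]_n) (c : R) : 0 < c -> psdmx A ->
  fro2 (invmx (A + c%:M)) <= n%:R / c ^+ 2.
Proof.
move=> c0 Apsd; set V := invmx _.
have MV : (A + c%:M) *m V = 1%:M by rewrite mulmxV// unitmx_psd_shift.
have := congr1 (fun M => \tr (V^T *m M)) MV.
rewrite mulmxDl mulmxDr mxtraceD mulmxA mul_scalar_mx -scalemxAr mxtraceZ -fro2E.
have := mxtrace_tr_mul_le V 1%:M c0.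
have -> : fro2 (1%:M : 'M[R]_n) = n%:R.
  by rewrite fro2E trmx1 mulmx1 mxtrace_scalar.
have : 0 <= \tr (V^T *m A *m V) by exact/psdmx_tr_ge0/psdmx_congr.
move=> h1 h2 h3. rewrite ler_pdivlMr ?exprn_gt0//.
have : c * (c * fro2 V) <= c * (c^-1 * n%:R) by apply: ler_wpM2l; [exact: ltW|lra].
by rewrite (mulrA c c^-1) divff ?gt_eqF// mul1r; lra.
Qed.

(** Quantitative form of [psdmx_sqr_inj]: a lower bound on [B] alone makes the Sylvester operator
    coercive, so [A] may be singular. *)
Lemma fro2_psd_sqr_diff n (A B : 'M[R]_n) (c : R) : 0 < c ->
  psdmx A -> psdmx (B - c%:M) ->
  fro2 (A - B) <= fro2 (A *m A - B *m B) / c ^+ 2.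
Proof.
move=> c0 Apsd Bpsd; set D := A - B; set E := A *m A - B *m B.
have DE : A *m D + D *m B = E by rewrite mulmxBr mulmxBl addrA subrK.
have := congr1 (fun M => \tr (D^T *m M)) DE.
rewrite mulmxDr mxtraceD mulmxA.
have h1 : 0 <= \tr (D^T *m A *m D) by exact/psdmx_tr_ge0/psdmx_congr.
have shiftE (X : 'M[R]_n) :
    \tr (X^T *m (X *m B)) = \tr (X *m (B - c%:M) *m X^T) + c * fro2 X.
  rewrite mxtrace_mulC mulmxBr mulmxBl mul_mx_scalar -scalemxAl.
  rewrite linearB /= mxtraceZ [\tr (X *m X^T)]mxtrace_mulC -fro2E.
  by rewrite subrK.
rewrite shiftE.
have h2 : 0 <= \tr (D *m (B - c%:M) *m D^T).
  by rewrite -{1}[D]trmxK; exact/psdmx_tr_ge0/psdmx_congr.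
have h3 := mxtrace_tr_mul_le D E c0.
move=> h4; rewrite ler_pdivlMr ?exprn_gt0//.
have : c * (c * fro2 D) <= c * (c^-1 * fro2 E) by apply: ler_wpM2l; [exact: ltW|lra].
by rewrite (mulrA c c^-1) divff ?gt_eqF// mul1r; lra.
Qed.

End frobenius.

(** * Orthogonal equivariance of [Gmx] and its values on diagonal matrices *)

Section matrix_functions.
Context {R : realType} {n : nat}.
Implicit Types (A B M P S T X Y : 'M[R]_n) (a l : 'rV[R]_n).

Lemma mulmx1_invmx A B : A *m B = 1%:M -> invmx A = B.
Proof.
move=> AB; have [Au _] := mulmx1_unit AB.
by rewrite -[LHS]mulmx1 -AB mulmxA mulVmx// mul1mx.
Qed.

Lemma conjmx_mul P A B : P^T *m P = 1%:M ->
  P *m A *m P^T *m (P *m B *m P^T) = P *m (A *m B) *m P^T.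
Proof. by move=> PtP; rewrite !mulmxA -[_ *m P^T *m P]mulmxA PtP mulmx1. Qed.

Lemma conjmx_scalar P c : P^T *m P = 1%:M -> P *m c%:M *m P^T = c%:M.
Proof.
by move=> /mulmx1C PPt; rewrite mul_mx_scalar -scalemxAl PPt scalemx1.
Qed.

Lemma invmx_conjmx P A : P^T *m P = 1%:M -> A \in unitmx ->
  invmx (P *m A *m P^T) = P *m invmx A *m P^T.
Proof.
move=> PtP Au; apply: mulmx1_invmx.
by rewrite conjmx_mul// mulmxV// conjmx_scalar.
Qed.

Lemma psdmx_conjmx P A : psdmx A -> psdmx (P *m A *m P^T).
Proof. by move=> Apsd; rewrite -{1}[P]trmxK; exact: psdmx_congr. Qed.

Lemma sqrtmx_conjmx P A : P^T *m P = 1%:M -> psdmx A ->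
  sqrtmx (P *m A *m P^T) = P *m sqrtmx A *m P^T.
Proof.
move=> PtP /sqrtmxP[Spsd SA]; apply: sqrtmx_unique.
  exact: psdmx_conjmx.
by rewrite conjmx_mul// SA.
Qed.

Lemma sqrtmx_diag a : (forall i, 0 <= a 0 i) ->
  sqrtmx (diag_mx a) = diag_mx (\row_i Num.sqrt (a 0 i)).
Proof.
move=> a0; have := @sqrtmx_conj_diag R n 1%:M a.
by rewrite trmx1 mulmx1 !mul1mx !mulmx1; apply.
Qed.

Lemma invmx_diag a : (forall i, a 0 i != 0) ->
  invmx (diag_mx a) = diag_mx (\row_i (a 0 i)^-1).
Proof.
move=> a0; apply: mulmx1_invmx; rewrite mulmx_diag -diag_const_mx.
by congr diag_mx; apply/rowP => i; rewrite !mxE divff.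
Qed.

Lemma psdmxD A B : psdmx A -> psdmx B -> psdmx (A + B).
Proof.
move=> [At A0] [Bt B0]; split; first by rewrite linearD /= At Bt.
by move=> x; rewrite mulmxDr mulmxDl mxE addr_ge0.
Qed.

Lemma psdmx_scalar (c : R) : 0 <= c -> psdmx (c%:M : 'M[R]_n).
Proof.
by move=> c0; rewrite -diag_const_mx; apply: psdmx_diag_mx => i; rewrite mxE.
Qed.

Lemma psdmx_sqrD A (c : R) : psdmx A -> psdmx (A *m A + (c ^+ 2)%:M).
Proof.
move=> [At _]; apply: psdmxD; first exact: psdmx_sqr.
exact/psdmx_scalar/sqr_ge0.
Qed.

Lemma psdmx_congrD A B (c : R) : psdmx A -> psdmx B ->
  psdmx (A *m B *m A + (c ^+ 2)%:M).
Proof.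
move=> [At _] Bpsd; apply: psdmxD; last exact/psdmx_scalar/sqr_ge0.
by rewrite -{1}At; exact: psdmx_congr.
Qed.

(** Roots, inverses, products and scalar matrices are all compatible with orthogonal conjugation;
    this moves the flow to the eigenbasis. *)
Lemma Gmx_conjmx eps P S T : 0 < eps -> P^T *m P = 1%:M ->
  psdmx T -> psdmx S ->
  Gmx eps (P *m T *m P^T) (P *m S *m P^T) = P *m Gmx eps T S *m P^T.
Proof.
move=> eps0 PtP Tpsd Spsd; rewrite /Gmx; set te := eps / 4.
have te0 : 0 < te by rewrite divr_gt0.
have [Qpsd _] := sqrtmxP Tpsd.
have U X : psdmx X -> invmx (sqrtmx (P *m X *m P^T) + te%:M) =
    P *m invmx (sqrtmx X + te%:M) *m P^T.
  move=> Xpsd; rewrite sqrtmx_conjmx// -{1}(conjmx_scalar te PtP).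
  rewrite -mulmxDl -mulmxDr invmx_conjmx//.
  by apply: unitmx_psd_shift => //; have [] := sqrtmxP Xpsd.
(* The right-hand side is hidden so that the rewrites only act on the left. *)
set G := RHS.
rewrite (sqrtmx_conjmx PtP Tpsd) -(conjmx_scalar (te ^+ 2) PtP) !conjmx_mul//.
rewrite -!mulmxDl -!mulmxDr.
rewrite !U; [|by apply: psdmx_congrD|by apply: psdmx_sqrD].
rewrite (conjmx_mul _ _ PtP) (conjmx_mul _ _ PtP) (conjmx_mul _ _ PtP).
have lin (X Y : 'M[R]_n) : P *m (2 *: X - 2 *: Y) *m P^T =
    2 *: (P *m X *m P^T) - 2 *: (P *m Y *m P^T).
  by rewrite mulmxBr mulmxBl -!scalemxAr -!scalemxAl.
by rewrite /G lin.
Qed.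

Lemma sqrt_shift_neq0 (x c : R) : 0 < c -> Num.sqrt x + c != 0.
Proof. by move=> c0; rewrite gt_eqF// ltr_wpDl ?sqrtr_ge0. Qed.

Lemma Gmx_diag eps a l : 0 < eps ->
  (forall i, 0 <= a 0 i) -> (forall i, 0 <= l 0 i) -> let te := eps / 4 in
  Gmx eps (diag_mx a) (diag_mx l) = diag_mx (\row_i
   (2 * (l 0 i / (Num.sqrt (l 0 i ^+ 2 + te ^+ 2) + te)) -
    2 * (a 0 i / (Num.sqrt (a 0 i * l 0 i + te ^+ 2) + te)))).
Proof.
move=> eps0 a0 l0 te; rewrite /Gmx -/te.
have te0 : 0 < te by rewrite divr_gt0.
rewrite (sqrtmx_diag a0) -!diag_const_mx !mulmx_diag -!linearD /=.
rewrite !sqrtmx_diag; last 2 first.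
- by move=> i; rewrite !mxE addr_ge0 ?sqr_ge0// mulr_ge0 ?mulr_ge0 ?sqrtr_ge0.
- by move=> i; rewrite !mxE addr_ge0 ?sqr_ge0// mulr_ge0.
rewrite -!linearD /= !invmx_diag; last 2 first.
- by move=> i; rewrite !mxE sqrt_shift_neq0.
- by move=> i; rewrite !mxE sqrt_shift_neq0.
rewrite !mulmx_diag -!linearZ /= -linearB; congr diag_mx.
apply/rowP => i; rewrite !mxE; congr (2 * (_ / (Num.sqrt _ + _)) - 2 * _).
rewrite mulrAC -expr2 sqr_sqrtr//; congr (_ / (Num.sqrt (_ + _) + _)).
by rewrite mulrAC -expr2 sqr_sqrtr.
Qed.

End matrix_functions.

(** * Lipschitz estimates between a matrix and its diagonal part *)

Section lipschitz.
Context {R : realType} {n : nat} (K : R).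
Implicit Types (f g : 'M[R]_n -> 'M[R]_n) (M : 'M[R]_n).

Definition diagpart M : 'M[R]_n := diag_mx (\row_i M i i).

Lemma psdmx_diagpart M : psdmx M -> psdmx (diagpart M).
Proof.
by move=> Mpsd; apply: psdmx_diag_mx => i; rewrite mxE psdmx_diag_ge0.
Qed.

(** The increment is only measured from [M] to [diagpart M], as Gronwall's inequality requires.
    Bounds on the values at both points are bundled in to make the class stable under products. *)
Definition diag_lipschitz f : Prop := exists2 C, 0 <= C &
  forall M, psdmx M -> fro2 M <= K ->
    [/\ fro2 (f M) <= C, fro2 (f (diagpart M)) <= C &
        fro2 (f M - f (diagpart M)) <= C * fro2 (M - diagpart M)].

Lemma fro2_diagpart M : fro2 (diagpart M) <= fro2 M.
Proof.
apply: ler_sum => i _; apply: ler_sum => j _; rewrite !mxE.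
by case: eqP => [->|_]; rewrite ?mulr1n// mulr0n expr0n /= sqr_ge0.
Qed.

Lemma diag_lipschitz_cst A : diag_lipschitz (fun=> A).
Proof.
exists (fro2 A); first exact: fro2_ge0.
by move=> M _ _; split=> //; rewrite subrr fro20 mulr_ge0// fro2_ge0.
Qed.

Lemma diag_lipschitz_id : diag_lipschitz id.
Proof.
(* One constant must serve as Lipschitz constant (at least 1) and as bound on the values (at least
   [K]). *)
exists (1 + `|K|); first by rewrite addr_ge0.
move=> M _ MK; have MK1 : fro2 M <= 1 + `|K|.
  by rewrite (le_trans MK)// (le_trans (ler_norm K))// lerDr.
split => //; first exact: le_trans (fro2_diagpart M) MK1.
by rewrite ler_peMl ?fro2_ge0// lerDl.
Qed.

Lemma diag_lipschitzD f g : diag_lipschitz f -> diag_lipschitz g ->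
  diag_lipschitz (fun M => f M + g M).
Proof.
move=> [C C0 fC] [D D0 gD]; exists (2 * C + 2 * D); first by lra.
move=> M Mpsd MK; have [f1 f2 f3] := fC M Mpsd MK.
have [g1 g2 g3] := gD M Mpsd MK; split.
- by apply: le_trans (le_fro2D _ _) _; lra.
- by apply: le_trans (le_fro2D _ _) _; lra.
- by rewrite opprD addrACA; apply: le_trans (le_fro2D _ _) _; lra.
Qed.

Lemma diag_lipschitzM f g : diag_lipschitz f -> diag_lipschitz g ->
  diag_lipschitz (fun M => f M *m g M).
Proof.
move=> [C C0 fC] [D D0 gD]; exists (4 * (C * D)).
  by rewrite mulr_ge0// mulr_ge0.
move=> M Mpsd MK; have [f1 f2 f3] := fC M Mpsd MK.
have [g1 g2 g3] := gD M Mpsd MK.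
have CD0 : 0 <= C * D by exact: mulr_ge0.
have le_prod (x y : R) : 0 <= x -> 0 <= y -> x <= C -> y <= D ->
    x * y <= 4 * (C * D).
  by move=> x0 y0 xC yD; have := ler_pM x0 y0 xC yD; lra.
split.
- by apply: le_trans (le_fro2M _ _) _; apply: le_prod; rewrite ?fro2_ge0.
- by apply: le_trans (le_fro2M _ _) _; apply: le_prod; rewrite ?fro2_ge0.
- apply: le_trans (le_fro2_mulB _ _ _ _) _.
  have := ler_pM (fro2_ge0 _) (fro2_ge0 _) f3 g1.
  have := ler_pM (fro2_ge0 _) (fro2_ge0 _) f2 g3.
  by lra.
Qed.

Lemma diag_lipschitzZ c f : diag_lipschitz f ->
  diag_lipschitz (fun M => c *: f M).
Proof.
move=> hf; have := diag_lipschitzM (diag_lipschitz_cst c%:M) hf.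
move=> [C C0 fC]; exists C => // M Mpsd MK; have := fC M Mpsd MK.
by rewrite !mul_scalar_mx.
Qed.

(* Only the square root at the diagonal matrix [f (diagpart M)] needs to be
   bounded below. *)
Lemma diag_lipschitz_inv_sqrt (c : R) f : 0 < c -> diag_lipschitz f ->
  (forall M, psdmx M -> psdmx (f M)) ->
  (forall M, psdmx M -> exists2 a : 'rV_n, f (diagpart M) = diag_mx a &
    forall i, c ^+ 2 <= a 0 i) ->
  diag_lipschitz (fun M => invmx (sqrtmx (f M) + c%:M)).
Proof.
move=> c0 [C C0 fC] fpsd fdiag; pose N : R := n%:R / c ^+ 2.
have N0 : 0 <= N by rewrite divr_ge0// sqr_ge0.
exists (N + N * (C / c ^+ 2 * N)).
  by rewrite addr_ge0// !mulr_ge0// invr_ge0 sqr_ge0.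
move=> M Mpsd MK; have [_ _ f3] := fC M Mpsd MK.
have [Spsd SE] := sqrtmxP (fpsd M Mpsd).
have [Dpsd DE] := sqrtmxP (fpsd _ (psdmx_diagpart Mpsd)).
have [a aE ca] := fdiag M Mpsd.
set S := sqrtmx (f M) in Spsd SE *.
set D := sqrtmx (f (diagpart M)) in Dpsd DE *.
have Su := unitmx_psd_shift c0 Spsd; have Du := unitmx_psd_shift c0 Dpsd.
have NN : N <= N + N * (C / c ^+ 2 * N).
  by rewrite lerDl !mulr_ge0// invr_ge0 sqr_ge0.
split.
- by apply: le_trans NN; exact: fro2_inv_psd_shift.
- by apply: le_trans NN; exact: fro2_inv_psd_shift.
(* The resolvent identity reduces the increment of the inverse to that of the root. *)
have -> : invmx (S + c%:M) - invmx (D + c%:M) =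
    - (invmx (S + c%:M) *m ((S - D) *m invmx (D + c%:M))).
  rewrite (_ : S - D = (S + c%:M) - (D + c%:M)); last first.
    by rewrite opprD addrACA subrr addr0.
  by rewrite mulmxBl mulmxV// mulmxBr mulKmx// mulmx1 opprB.
rewrite fro2N.
have SD : fro2 (S - D) <= C * fro2 (M - diagpart M) / c ^+ 2.
  apply: le_trans (fro2_psd_sqr_diff c0 Spsd _) _; last first.
    by rewrite SE DE ler_pM2r// invr_gt0 exprn_gt0.
  (* At the diagonal matrix the root has entries at least [c], which is the coercivity that
     [fro2_psd_sqr_diff] asks for. *)
  rewrite /D aE sqrtmx_diag; last first.
    by move=> i; rewrite (le_trans _ (ca i))// sqr_ge0.
  rewrite -diag_const_mx -linearB; apply: psdmx_diag_mx => i.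
  by rewrite !mxE subr_ge0 -[leLHS]gtr0_norm// -sqrtr_sqr ler_wsqrtr.
apply: le_trans (le_fro2M _ _) _.
apply: le_trans (ler_pM (fro2_ge0 _) (fro2_ge0 _)
  (fro2_inv_psd_shift c0 Spsd) (le_fro2M _ _)) _.
apply: (@le_trans _ _ (N * (C * fro2 (M - diagpart M) / c ^+ 2 * N))).
  apply: ler_wpM2l => //; apply: ler_pM; rewrite ?fro2_ge0//.
  exact: fro2_inv_psd_shift.
rewrite [leRHS]mulrDl (_ : N * (C * _ / _ * N) =
  N * (C / c ^+ 2 * N) * fro2 (M - diagpart M)); last by ring.
by rewrite lerDr mulr_ge0// fro2_ge0.
Qed.

End lipschitz.

Section flow_field.
Context {R : realType} {n : nat}.

Definition flow_field (eps : R) (T S : 'M[R]_n) : 'M[R]_n :=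
  - (Gmx eps T S *m S + S *m Gmx eps T S).

(** The field is assembled by sums and products from the identity, constants (among them the root of
    the target) and two regularized inverse roots. *)
Lemma flow_field_lipschitz (eps K : R) (a : 'rV[R]_n) : 0 < eps ->
  (forall i, 0 <= a 0 i) ->
  diag_lipschitz K (flow_field eps (diag_mx a)).
Proof.
move=> eps0 a0; set te := eps / 4.
have te0 : 0 < te by rewrite divr_gt0.
have Tpsd := psdmx_diag_mx a0; have [Qpsd _] := sqrtmxP Tpsd.
have lip1 : diag_lipschitz K
    (fun S : 'M[R]_n => invmx (sqrtmx (S *m S + (te ^+ 2)%:M) + te%:M)).
  apply: (diag_lipschitz_inv_sqrt (f := fun S => S *m S + (te ^+ 2)%:M)) => //.
  - apply: diag_lipschitzD; last exact: diag_lipschitz_cst.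
    by apply: diag_lipschitzM; exact: diag_lipschitz_id.
  - by move=> M; exact: psdmx_sqrD.
  - move=> M Mpsd; rewrite /diagpart mulmx_diag -diag_const_mx -linearD.
    eexists; first by [].
    by move=> i; rewrite !mxE lerDr -expr2 sqr_ge0.
have lip2 : diag_lipschitz K (fun S : 'M[R]_n =>
    invmx (sqrtmx (sqrtmx (diag_mx a) *m S *m sqrtmx (diag_mx a)
                   + (te ^+ 2)%:M) + te%:M)).
  apply: (diag_lipschitz_inv_sqrt (f := fun S =>
    sqrtmx (diag_mx a) *m S *m sqrtmx (diag_mx a) + (te ^+ 2)%:M)) => //.
  - apply: diag_lipschitzD; last exact: diag_lipschitz_cst.
    apply: diag_lipschitzM; last exact: diag_lipschitz_cst.
    by apply: diag_lipschitzM; [exact: diag_lipschitz_cst|exact: diag_lipschitz_id].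
  - by move=> M; exact: psdmx_congrD.
  - move=> M Mpsd; rewrite sqrtmx_diag// /diagpart !mulmx_diag.
    rewrite -diag_const_mx -linearD; eexists; first by [].
    move=> i; rewrite !mxE lerDr mulr_ge0 ?sqrtr_ge0// mulr_ge0 ?sqrtr_ge0//.
    exact: psdmx_diag_ge0.
have lipG : diag_lipschitz K (Gmx eps (diag_mx a)).
  apply: diag_lipschitzD.
    by apply/diag_lipschitzZ/diag_lipschitzM => //; exact: diag_lipschitz_id.
  under [X in diag_lipschitz _ X]funext do rewrite -scaleN1r.
  apply/diag_lipschitzZ/diag_lipschitzZ/diag_lipschitzM.
    by apply: diag_lipschitzM => //; exact: diag_lipschitz_cst.
  exact: diag_lipschitz_cst.
rewrite /flow_field; under [X in diag_lipschitz _ X]funext do rewrite -scaleN1r.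
apply/diag_lipschitzZ/diag_lipschitzD; apply: diag_lipschitzM => //;
  exact: diag_lipschitz_id.
Qed.

End flow_field.

(** * The flow *)

Section monotone.
Context {R : realType}.
Implicit Types (f g dg : R -> R) (a b : R).

Lemma le_of_derive_le0 g dg a b : a <= b -> {within `[a, b], continuous g} ->
  (forall x, a < x -> x < b -> is_derive x (1 : R) g (dg x)) ->
  (forall x, a < x -> x < b -> dg x <= 0) -> g b <= g a.
Proof.
move=> ab cg dgE dg0.
apply: (ler0_derive1_le_cc (f := g) (a := a) (b := b)) => //.
- by move=> x; rewrite in_itv/= => /andP[ax xb]; have := dgE x ax xb; case.
- move=> x; rewrite in_itv/= => /andP[ax xb].
  by rewrite derive1E; have [_ ->] := dgE x ax xb; exact: dg0.
- by rewrite in_itv/= lexx ab.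
- by rewrite in_itv/= lexx ab.
Qed.

Lemma within_continuous_exp_mul a b f c : {within `[a, b], continuous f} ->
  {within `[a, b], continuous (fun s => f s * expR (c * s))}.
Proof.
move=> /subspace_continuousP cf; apply/subspace_continuousP => x xab.
apply: cvgM; first exact: cf.
apply: (cvg_comp (fun s : R => c * s) expR); last exact: continuous_expR.
apply: cvg_within_filter; apply: cvgM; [exact: cvg_cst|exact: cvg_id].
Qed.

Lemma cvg_sqr (T : Type) (F : set_system T) (f : T -> R) (l : R) : Filter F ->
  f x @[x --> F] --> l -> f x ^+ 2 @[x --> F] --> l ^+ 2.
Proof.
by move=> FF fl; apply: (cvg_comp f (fun y : R => y ^+ 2) fl); exact: sqr_continuous.
Qed.

Lemma within_continuous_sqr_diff a b f l : {within `[a, b], continuous f} ->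
  {within `[a, b], continuous (fun s => (f s - l) ^+ 2)}.
Proof.
move=> /subspace_continuousP cf; apply/subspace_continuousP => x xab.
by apply: cvg_sqr; apply: cvgB; [exact: cf|exact: cvg_cst].
Qed.

Lemma is_derive_exp_mul f df c x : is_derive x (1 : R) f df ->
  is_derive x (1 : R) (fun s => f s * expR (c * s))
    ((df + c * f x) * expR (c * x)).
Proof.
move=> fx.
have e1 : is_derive x (1 : R) (expR \o (fun s : R => c *: s)) (expR (c * x) * c).
  apply: is_derive1_comp.
  by apply: is_derive_eq; rewrite /GRing.scale/= mulr1.
have := is_deriveM fx e1.
rewrite /GRing.scale/= => h; apply: is_derive_eq h _; ring.
Qed.

Lemma is_derive_sqr_diff f df l x : is_derive x (1 : R) f df ->
  is_derive x (1 : R) (fun s => (f s - l) ^+ 2) (2 * (f x - l) * df).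
Proof.
move=> fx.
have := is_deriveX 2 (is_deriveB fx (is_derive_cst l x (1 : R))).
rewrite /GRing.scale/= => h; apply: is_derive_eq h _.
rewrite subr0 expr1; by [].
Qed.

(** The product of [g] with [expR (- c * s)] is nonincreasing. The sign of [c] is free: growth for
    the off-diagonal part, decay for the eigenvalues. *)
Lemma gronwall g dg a b c : a <= b ->
  {within `[a, b], continuous g} ->
  (forall x, a < x -> x < b -> is_derive x (1 : R) g (dg x)) ->
  (forall x, a < x -> x < b -> dg x <= c * g x) ->
  g b <= expR (c * (b - a)) * g a.
Proof.
move=> ab cg dgE dgc.
have := @le_of_derive_le0 (fun s => g s * expR (- c * s))
  (fun s => (dg s + - c * g s) * expR (- c * s)) a b ab.
move=> /(_ (within_continuous_exp_mul cg)) h.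
have {h} : g b * expR (- c * b) <= g a * expR (- c * a).
  apply: h => x ax xb; first exact/is_derive_exp_mul/dgE.
  by rewrite mulr_le0_ge0 ?expR_ge0//; have := dgc x ax xb; lra.
rewrite !mulNr !expRN ler_pdivrMr ?expR_gt0// => /le_trans; apply.
by rewrite mulrBr expRD expRN [leRHS]mulrC mulrA mulrAC.
Qed.

End monotone.

(** * The scalar equation of an eigenvalue and its rates of convergence *)

Section eigenvalue_flow.
Context {R : realType}.
Variables (eps l : R) (lam : R -> R).
Hypotheses (eps0 : 0 < eps) (l0 : 0 <= l).
Let te := eps / 4.

Definition eigen_field (x : R) : R :=
  4 * x * (l / (Num.sqrt (l * x + te ^+ 2) + te)
           - x / (Num.sqrt (x ^+ 2 + te ^+ 2) + te)).

(** The factor left by rationalizing the difference of square roots, whose squares differ by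
    [x * (l - x)]; it is the instantaneous rate of contraction towards [l]. *)
Definition eigen_rate (x : R) : R :=
  4 * x / (Num.sqrt (l * x + te ^+ 2) + Num.sqrt (x ^+ 2 + te ^+ 2)).

Let te0 : 0 < te. Proof. by rewrite divr_gt0. Qed.

Let sqrtA_ge x : 0 <= x -> te <= Num.sqrt (l * x + te ^+ 2).
Proof.
move=> x0; rewrite -[leLHS]gtr0_norm// -sqrtr_sqr ler_wsqrtr// lerDr.
exact: mulr_ge0.
Qed.

Let sqrtB_ge x : te <= Num.sqrt (x ^+ 2 + te ^+ 2).
Proof. by rewrite -[leLHS]gtr0_norm// -sqrtr_sqr ler_wsqrtr// lerDr sqr_ge0. Qed.

(* [l x / (sqrt (l x + te^2) + te) = sqrt (l x + te^2) - te], so the field is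
   four times a difference of square roots. *)
Lemma eigen_fieldE x : 0 <= x -> eigen_field x = - (eigen_rate x * (x - l)).
Proof.
move=> x0; rewrite /eigen_field /eigen_rate; have te0' := te0.
set A := Num.sqrt (l * x + _); set B := Num.sqrt (x ^+ 2 + _).
have A0 : te <= A by exact: sqrtA_ge.
have B0 : te <= B by exact: sqrtB_ge.
have A2 : A ^+ 2 = l * x + te ^+ 2 by rewrite sqr_sqrtr// addr_ge0 ?sqr_ge0// mulr_ge0.
have B2 : B ^+ 2 = x ^+ 2 + te ^+ 2 by rewrite sqr_sqrtr// addr_ge0 ?sqr_ge0.
have e1 : x * (l / (A + te)) = A - te.
  have : A + te != 0 by rewrite gt_eqF//; lra.
  move=> h; rewrite mulrA; apply: (canLR (mulfK h)).
  by rewrite -subr_sqr A2; ring.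
have e2 : x * (x / (B + te)) = B - te.
  have : B + te != 0 by rewrite gt_eqF//; lra.
  move=> h; rewrite mulrA; apply: (canLR (mulfK h)).
  by rewrite -subr_sqr B2; ring.
rewrite -mulrA mulrBr e1 e2.
have h : A + B != 0 by rewrite gt_eqF//; lra.
have -> : A - te - (B - te) = (A ^+ 2 - B ^+ 2) / (A + B).
  by rewrite subr_sqr mulfK//; ring.
by rewrite A2 B2; field.
Qed.

Lemma eigen_rate_ge0 x : 0 <= x -> 0 <= eigen_rate x.
Proof.
by move=> x0; rewrite divr_ge0 ?mulr_ge0.
Qed.

(** The roots increase with [x], so they are at most their values [A'], [B'] at the maximum. The
    factor [te] of [rate_a] turns the sum of roots into a product:
    [te * (A + B) <= (A' + te) * (B' + te)]. *)
Lemma rate_a_le x x0 : 0 <= x0 -> Num.min l x0 <= x -> x <= Num.max x0 l ->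
  rate_a eps x0 l <= eigen_rate x.
Proof.
move=> x00 minx xmax; have te0' := te0; rewrite /rate_a /eigen_rate -/te.
have m0 : 0 <= Num.min l x0 by rewrite le_min l0.
have x_ge0 : 0 <= x by exact: le_trans minx.
have M0 : 0 <= Num.max x0 l by rewrite le_max x00.
have := sqrtA_ge x_ge0; have := sqrtB_ge x.
have : Num.sqrt (l * x + te ^+ 2) <= Num.sqrt (l * Num.max x0 l + te ^+ 2).
  by rewrite ler_wsqrtr// lerD2r ler_wpM2l.
have : Num.sqrt (x ^+ 2 + te ^+ 2) <= Num.sqrt (Num.max x0 l ^+ 2 + te ^+ 2).
  by rewrite ler_wsqrtr// lerD2r lerXn2r.
set A := Num.sqrt (l * x + _); set B := Num.sqrt (x ^+ 2 + _).
set A' := Num.sqrt (l * _ + _); set B' := Num.sqrt (_ ^+ 2 + _).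
move=> BB' AA' teB teA.
have AB0 : 0 < A + B by lra.
have A'B'0 : 0 < (A' + te) * (B' + te) by apply: mulr_gt0; lra.
rewrite ler_pdivrMr// [leRHS]mulrAC ler_pdivlMr//.
have h1 : te * (A + B) <= (A' + te) * (B' + te) by nra.
have -> : 4 * te * Num.min l x0 * (A + B) = 4 * (Num.min l x0 * (te * (A + B))).
  by ring.
rewrite -[leRHS]mulrA ler_pM2l//; apply: ler_pM => //.
by rewrite mulr_ge0// ltW.
Qed.

Hypothesis lam_ge0 : forall t : R, 0 <= t -> 0 <= lam t.
Hypothesis lam_cont : {within `[0, +oo[, continuous lam}.
Hypothesis lam_flow : forall t : R, 0 < t ->
  is_derive t (1 : R) lam (eigen_field (lam t)).

Lemma lam_cont_itv (a b : R) : 0 <= a -> {within `[a, b], continuous lam}.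
Proof.
move=> a0; apply: continuous_subspaceW lam_cont => x /=.
by rewrite !in_itv/= andbT => /andP[ax _]; exact: le_trans ax.
Qed.

(** The squared distance to [l] is a Lyapunov function, on whichever side of [l] the eigenvalue
    lies. *)
Lemma lam_sqr_diff_nincr (s t : R) : 0 <= s -> s <= t ->
  (lam t - l) ^+ 2 <= (lam s - l) ^+ 2.
Proof.
move=> s0 st.
apply: (le_of_derive_le0 (g := fun r => (lam r - l) ^+ 2)
  (dg := fun r => 2 * (lam r - l) * eigen_field (lam r))) => //.
- exact/within_continuous_sqr_diff/lam_cont_itv.
- move=> x sx _; apply/is_derive_sqr_diff/lam_flow; exact: le_lt_trans sx.
- move=> x sx _; have x0 : 0 <= lam x by apply/lam_ge0/ltW; exact: le_lt_trans sx.
  rewrite eigen_fieldE// mulrN oppr_le0.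
  have -> : 2 * (lam x - l) * (eigen_rate (lam x) * (lam x - l)) =
    2 * eigen_rate (lam x) * (lam x - l) ^+ 2 by ring.
  by rewrite mulr_ge0 ?sqr_ge0// mulr_ge0// eigen_rate_ge0.
Qed.

Lemma lam_eq_target (s t : R) : 0 <= s -> s <= t -> lam s = l -> lam t = l.
Proof.
move=> s0 st ls; have := lam_sqr_diff_nincr s0 st.
rewrite ls subrr expr0n/= => h.
have : (lam t - l) ^+ 2 == 0 by rewrite eq_le h sqr_ge0.
by rewrite sqrf_eq0 subr_eq0 => /eqP.
Qed.

Lemma lam_between (t : R) : 0 <= t ->
  Num.min l (lam 0) <= lam t /\ lam t <= Num.max (lam 0) l.
Proof.
move=> t0; have := lam_sqr_diff_nincr (lexx 0) t0 => hsq.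
(* An eigenvalue that crosses [l] meets it at some time by the intermediate value theorem, and stays
   there by [lam_eq_target]. *)
have cross : Num.min (lam 0) (lam t) <= l <= Num.max (lam 0) (lam t) ->
    lam t = l.
  move=> /(IVT t0 (lam_cont_itv (b := t) (lexx 0)))[c].
  by rewrite in_itv/= => /andP[c0 ct] /lam_eq_target -/(_ t c0 ct).
have [l_lam0|lam0_l] := leP l (lam 0).
- have [lt_l|l_lt] := ltP (lam t) l.
    have : lam t = l by apply: cross; rewrite ge_min le_max (ltW lt_l) l_lam0 orbT.
    by move=> E; rewrite E ltxx in lt_l.
  split => //.
  have : `|lam t - l| <= `|lam 0 - l| by rewrite -ler_sqr ?nnegrE// !real_normK ?num_real.
  by rewrite !ger0_norm ?subr_ge0// lerD2r.
- have [l_lt|lt_l] := ltP l (lam t).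
    have : lam t = l.
      by apply: cross; rewrite ge_min le_max (ltW lam0_l) (ltW l_lt) orbT.
    by move=> E; rewrite E ltxx in l_lt.
  split => //.
  have : `|lam t - l| <= `|lam 0 - l| by rewrite -ler_sqr ?nnegrE// !real_normK ?num_real.
  by rewrite !ler0_norm ?subr_le0 ?(ltW lam0_l)// lerN2 lerD2r.
Qed.

Lemma lam_exp_decay (t : R) : 0 <= t ->
  `|lam t - l| <= expR (- (rate_a eps (lam 0) l * t)) * `|lam 0 - l|.
Proof.
move=> t0; set c := rate_a _ _ _.
have := @gronwall R (fun r => (lam r - l) ^+ 2)
  (fun r => 2 * (lam r - l) * eigen_field (lam r)) 0 t (- (2 * c)) t0.
move=> /(_ (within_continuous_sqr_diff (lam_cont_itv (lexx 0)))) h.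
have {h} : (lam t - l) ^+ 2 <= expR (- (2 * c) * (t - 0)) * (lam 0 - l) ^+ 2.
  apply: h => x x0 _; first exact/is_derive_sqr_diff/lam_flow.
  have lx0 := lam_ge0 (ltW x0); rewrite eigen_fieldE//.
  have [minx xmax] := lam_between (ltW x0).
  have := rate_a_le (lam_ge0 (lexx 0)) minx xmax; rewrite -/c => crate.
  rewrite -subr_ge0 (_ : _ - _ =
    2 * (eigen_rate (lam x) - c) * (lam x - l) ^+ 2); last by ring.
  by rewrite mulr_ge0 ?sqr_ge0// mulr_ge0// subr_ge0.
(* Halving the exponent exhibits the right-hand side as a square, so that the root can be taken. *)
rewrite subr0 (_ : - (2 * c) * t = - (c * t) + - (c * t)); last by ring.
rewrite expRD -expr2 -[X in X <= _]real_normK ?num_real//.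
by rewrite -[X in _ <= _ * X]real_normK ?num_real// -exprMn ler_sqr ?nnegrE.
Qed.

(** For [l = 0] the equation reads [lam' = - 4 lam ^+ 2 / (B + te)] with [B] the remaining root, so
    the inverse of [lam] grows at speed at least [c], since [B] is largest at time 0. *)
Lemma lam_hyperbolic_decay (t : R) : l = 0 -> 0 <= t ->
  lam t <= lam 0 / (1 + lam 0 * rate_b eps (lam 0) * t).
Proof.
move=> lE t0; set c := rate_b _ _.
have lam00 := lam_ge0 (lexx 0).
have c0 : 0 < c.
  rewrite /c /rate_b -/te divr_gt0//.
  by have := sqrtB_ge (lam 0); have := te0; lra.
have den0 : 0 < 1 + lam 0 * c * t by rewrite ltr_wpDr// mulr_ge0// mulr_ge0// ltW.
(* Inverses are only available when [lam t] is positive; by monotonicity [lam] is then positive on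
   the whole interval. *)
have [lamt0|lamt0] := leP (lam t) 0.
  by apply: le_trans lamt0 _; rewrite divr_ge0// ltW.
have lam_nincr (s r : R) : 0 <= s -> s <= r -> lam r <= lam s.
  move=> s0 sr; have := lam_sqr_diff_nincr s0 sr; rewrite lE !subr0.
  by rewrite ler_sqr ?nnegrE ?lam_ge0//; exact: le_trans sr.
have lam_gt0 (s : R) : 0 <= s -> s <= t -> 0 < lam s.
  by move=> s0 st; exact: lt_le_trans (lam_nincr s t s0 st).
have : - (lam t)^-1 + c * t <= - (lam 0)^-1 + c * 0.
  apply: (le_of_derive_le0 (g := fun s => - (lam s)^-1 + c * s)
    (dg := fun s => (lam s) ^- 2 * eigen_field (lam s) + c)) => //.
  - apply/subspace_continuousP => x xab.
    have /subspace_continuousP/(_ x xab) lamx := lam_cont_itv (b := t) (lexx 0).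
    move: xab; rewrite /= in_itv/= => /andP[x0 xt].
    apply: cvgD; first by apply: cvgN; apply: cvgV => //; rewrite gt_eqF// lam_gt0.
    by apply: cvg_within_filter; apply: cvgM; [exact: cvg_cst|exact: cvg_id].
  - move=> x x0 xt.
    have lx : lam x != 0 by rewrite gt_eqF// lam_gt0// ltW.
    have h1 := is_deriveN (is_deriveV lx (lam_flow x0)).
    have h2 : is_derive x (1 : R) (fun s => c *: s) c.
      by apply: is_derive_eq; rewrite /GRing.scale/= mulr1.
    apply: is_derive_eq (is_deriveD h1 h2) _.
    by rewrite /GRing.scale/= mulNr opprK.
  - move=> x x0 xt; have lx := lam_gt0 _ (ltW x0) (ltW xt).
    rewrite /eigen_field lE mul0r sub0r.
    have lx0 := lam_nincr 0 x (lexx 0) (ltW x0).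
    set B := Num.sqrt _; have := sqrtB_ge (lam x); rewrite -/B => teB.
    have BB : B <= Num.sqrt (lam 0 ^+ 2 + te ^+ 2).
      by rewrite ler_wsqrtr// lerD2r lerXn2r// nnegrE ltW.
    have -> : lam x ^- 2 * (4 * lam x * - (lam x / (B + te))) = - (4 / (B + te)).
      by field; rewrite !gt_eqF//; have := te0; lra.
    rewrite addrC subr_le0 /c /rate_b -/te ler_pM2l// lef_pV2 ?posrE; have := te0; lra.
rewrite mulr0 addr0 => h.
have lam0_gt0 := lam_gt0 0 (lexx 0) t0.
rewrite ler_pdivlMr//.
have : lam t * lam 0 * (- (lam t)^-1 + c * t) <= lam t * lam 0 * - (lam 0)^-1.
  by rewrite ler_wpM2l// mulr_ge0// ltW.
rewrite mulrDr !mulrN [_ * (lam t)^-1]mulrAC divff ?gt_eqF// mul1r.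
by rewrite mulfK ?gt_eqF//; lra.
Qed.

End eigenvalue_flow.

(** * From the matrix flow in the eigenbasis to the scalar equations *)

Section matrix_flow.
Context {R : realType} {n : nat}.
Implicit Types (M : R -> 'M[R]_n) (A B D : 'M[R]_n).

Lemma cvg_sum_fin (T : Type) (F : set_system T) (I : Type) (r : seq I)
    (f : I -> T -> R) (l : I -> R) : Filter F ->
  (forall i, f i x @[x --> F] --> l i) ->
  \sum_(i <- r) f i x @[x --> F] --> \sum_(i <- r) l i.
Proof.
move=> FF fl; elim: r => [|i r IH].
  by under eq_fun do rewrite big_nil; rewrite big_nil; exact: cvg_cst.
by under eq_fun do rewrite big_cons; rewrite big_cons; exact: cvgD.
Qed.

Lemma is_derive_sum_fun m (f : 'I_m -> R -> R) (df : 'I_m -> R) (x : R) :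
  (forall i, is_derive x (1 : R) (f i) (df i)) ->
  is_derive x (1 : R) (fun s => \sum_i f i s) (\sum_i df i).
Proof.
move=> fdf; rewrite (_ : (fun s => _) = \sum_i f i); first exact: is_derive_sum.
by apply/funext => s; rewrite fct_sumE.
Qed.

Lemma is_derive_mx_entry M D (t : R) i j : is_derive t (1 : R) M D ->
  is_derive t (1 : R) (fun s => M s i j) (D i j).
Proof.
move=> [dM dE]; have /derivable_mxP/(_ i j) dMij := dM.
by apply: DeriveDef => //; rewrite -dE derive_mx// mxE.
Qed.

(** An entry as a fixed linear combination of the entries of [D], the form in which continuity and
    derivatives are transferred. *)
Lemma mulmx3E A D B i j :
  (A *m D *m B) i j = \sum_k \sum_l A i k * B l j * D k l.
Proof.
rewrite mxE exchange_big; apply: eq_bigr => l _ /=.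
by rewrite mxE mulr_suml; apply: eq_bigr => k _; rewrite mulrAC.
Qed.

Lemma is_derive_mulmx3 A B M D (t : R) i j : is_derive t (1 : R) M D ->
  is_derive t (1 : R) (fun s => (A *m M s *m B) i j) ((A *m D *m B) i j).
Proof.
move=> MD; rewrite mulmx3E; under eq_fun do rewrite mulmx3E.
apply: is_derive_sum_fun => k; apply: is_derive_sum_fun => l.
exact: is_deriveZ (is_derive_mx_entry k l MD).
Qed.

Lemma within_continuous_mulmx3 (I : set R) A B M i j :
  {within I, continuous M} ->
  {within I, continuous (fun s => (A *m M s *m B) i j)}.
Proof.
move=> /subspace_continuousP cM.
rewrite (_ : (fun s => _) = fun s => \sum_k \sum_l A i k * B l j * M s k l);
  last by apply/funext => s; rewrite mulmx3E.
apply/subspace_continuousP => x Ix.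
apply: cvg_sum_fin => k; apply: cvg_sum_fin => l.
apply: cvgM; first exact: cvg_cst.
apply: (cvg_comp M (fun D : 'M[R]_n => D k l)); first exact: cM.
exact: coord_continuous.
Qed.

Lemma fro2_le0 D : fro2 D <= 0 -> D = 0.
Proof.
move=> D0; apply/matrixP => i j; rewrite [RHS]mxE.
have h0 k l : 0 <= D k l ^+ 2 by exact: sqr_ge0.
have : D i j ^+ 2 <= 0.
  apply: le_trans D0; rewrite /fro2 (bigD1 i)//= (bigD1 j)//= -addrA lerDl.
  by rewrite addr_ge0// sumr_ge0// => k _; rewrite sumr_ge0.
by move=> Dij; apply/eqP; rewrite -sqrf_eq0 eq_le Dij h0.
Qed.

Lemma fro2_offdiagE D :
  fro2 (D - diagpart D) = \sum_i \sum_j (i != j)%:R * D i j ^+ 2.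
Proof.
apply: eq_bigr => i _; apply: eq_bigr => j _; rewrite !mxE.
by case: eqP => [->|_]; rewrite ?mulr1n ?mulr0n ?subrr ?subr0 ?expr0n ?mul0r ?mul1r.
Qed.

Variables (eps : R) (a : 'rV[R]_n) (M : R -> 'M[R]_n).
Hypotheses (eps0 : 0 < eps) (a0 : forall i, 0 <= a 0 i).
Hypothesis M_psd : forall t : R, 0 <= t -> psdmx (M t).
Hypothesis M_cont :
  forall i j, {within `[0, +oo[, continuous (fun s => M s i j)}.
Hypothesis M_flow : forall (t : R) i j, 0 < t ->
  is_derive t (1 : R) (fun s => M s i j)
    (flow_field eps (diag_mx a) (M t) i j).

Lemma flow_field_diag (l : 'rV[R]_n) : (forall i, 0 <= l 0 i) ->
  flow_field eps (diag_mx a) (diag_mx l) =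
  diag_mx (\row_i eigen_field eps (a 0 i) (l 0 i)).
Proof.
move=> l0; rewrite /flow_field Gmx_diag// !mulmx_diag -linearD -linearN.
congr diag_mx; apply/rowP => i; rewrite !mxE /eigen_field; ring.
Qed.

Let M_cvg i j (x : R) : 0 <= x ->
  M s i j @[s --> within `[0, +oo[ (nbhs x)] --> M x i j.
Proof.
move=> x0; have /subspace_continuousP := @M_cont i j; apply.
by rewrite /= in_itv/= andbT.
Qed.

Let cont_itv (f : R -> R) (t : R) :
  (forall x : R, 0 <= x -> f s @[s --> within `[0, +oo[ (nbhs x)] --> f x) ->
  {within `[0, t], continuous f}.
Proof.
move=> cf; have : {within `[0, +oo[, continuous f}.
  by apply/subspace_continuousP => x /=; rewrite in_itv/= andbT; exact: cf.
apply: continuous_subspaceW => x /=.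
by rewrite !in_itv/= andbT => /andP[].
Qed.

(* The field maps diagonal matrices to diagonal matrices and is locally
   Lipschitz, so Gronwall's inequality applies to the off-diagonal part. *)
Lemma flow_offdiag_eq0 (t : R) : 0 <= t -> M 0 = diagpart (M 0) ->
  M t = diagpart (M t).
Proof.
move=> t0 M0; pose F s := flow_field eps (diag_mx a) (M s).
(* Compactness of [[0, t]] supplies the bound [K] for the local Lipschitz estimate. *)
have [c _ cmax] : exists2 c, c \in `[0, t]%R &
    forall s, s \in `[0, t]%R -> fro2 (M s) <= fro2 (M c).
  apply: EVT_max => //; apply: cont_itv => x x0.
  apply: cvg_sum_fin => i; apply: cvg_sum_fin => j.
  by apply: cvg_sqr; exact: M_cvg.
have [C C0 FC] := flow_field_lipschitz (fro2 (M c)) eps0 a0.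
pose phi s := fro2 (M s - diagpart (M s)).
have phiE : phi = fun s => \sum_i \sum_j (i != j)%:R * M s i j ^+ 2.
  by apply/funext => s; rewrite /phi fro2_offdiagE.
(* In [1 + C], the [1] comes from [2 m f <= m ^+ 2 + f ^+ 2] on each off-diagonal entry [m] with
   derivative [f], and [C] from the Lipschitz estimate for the sum of the [f ^+ 2]. *)
have := @gronwall R phi
  (fun s => \sum_i \sum_j (i != j)%:R * (2 * M s i j * F s i j)) 0 t (1 + C) t0.
have phi_cont : {within `[0, t], continuous phi}.
  rewrite phiE; apply: cont_itv => x x0.
  apply: cvg_sum_fin => i; apply: cvg_sum_fin => j.
  apply: cvgM; first exact: cvg_cst.
  by apply: cvg_sqr; exact: M_cvg.
move=> /(_ phi_cont) h.
have {h} : phi t <= expR ((1 + C) * (t - 0)) * phi 0.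
  apply: h => x x0 xt.
  - rewrite phiE; apply: is_derive_sum_fun => i; apply: is_derive_sum_fun => j.
    have h := is_derive_sqr_diff 0 (M_flow i j x0).
    have {h} h := is_deriveZ (i != j)%:R h.
    rewrite (_ : (fun s => _) =
        (i != j)%:R *: (fun s => (M s i j - 0) ^+ 2)); last first.
      apply/funext => s.
      by rewrite -[RHS]/((i != j)%:R * (M s i j - 0) ^+ 2) subr0.
    by apply: is_derive_eq h _; rewrite subr0.
  - have Mx := M_psd (ltW x0).
    have MK : fro2 (M x) <= fro2 (M c).
      by apply: cmax; rewrite in_itv/= !ltW.
    have [_ _ lip] := FC (M x) Mx MK.
    rewrite mulrDl mul1r; apply: le_trans (lerD (lexx _) lip).
    rewrite {1}phiE [X in _ <= _ + X]/fro2 -big_split.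
    apply: ler_sum => i _ /=; rewrite -big_split; apply: ler_sum => j _ /=.
    have [_|ij] := eqVneq i j; first by rewrite /= !mul0r add0r sqr_ge0.
    (* The field at [diagpart (M x)] vanishes off the diagonal, so the increment controlled by [lip]
       is the entry of [F x] itself. *)
    have offE (G : 'M[R]_n) v : (G - diag_mx v) i j = G i j.
      by rewrite !mxE (negbTE ij) mulr0n subr0.
    rewrite /diagpart flow_field_diag; last first.
      by move=> k; rewrite mxE psdmx_diag_ge0.
    rewrite offE !mul1r -/(F x).
    by have := sqr_ge0 (M x i j - F x i j); nra.
rewrite {2}/phi -M0 subrr fro20 mulr0 => phit0.
by apply/eqP; rewrite -subr_eq0; apply/eqP; exact: fro2_le0.
Qed.

Lemma flow_eigenvalue i (t : R) : 0 < t -> M 0 = diagpart (M 0) ->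
  is_derive t (1 : R) (fun s => M s i i) (eigen_field eps (a 0 i) (M t i i)).
Proof.
move=> t0 M0; have Mt := flow_offdiag_eq0 (ltW t0) M0.
have FE : flow_field eps (diag_mx a) (M t) =
    diag_mx (\row_k eigen_field eps (a 0 k) (M t k k)).
  rewrite {1}Mt /diagpart flow_field_diag; last first.
    by move=> k; rewrite mxE; apply/psdmx_diag_ge0/M_psd/ltW.
  by congr diag_mx; apply/rowP => k; rewrite !mxE.
by have := M_flow i i t0; rewrite FE [X in is_derive _ _ _ X]mxE eqxx mulr1n mxE.
Qed.

End matrix_flow.

(** * Relative entropy and couplings *)

Section density.
Local Open Scope ereal_scope.
Context {R : realType} d {T : measurableType d}.
Implicit Types (p : probability T R) (q : {sigma_finite_measure set T -> \bar R}).
Implicit Types (h : T -> R).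

(** A real-valued, everywhere nonnegative version of the Radon-Nikodym derivative, which can be
    inverted and composed with maps pointwise. *)
Definition is_density p q h : Prop :=
  [/\ measurable_fun setT h, (forall x, (0 <= h x)%R)
    & forall A, measurable A -> p A = \int[q]_(x in A) (h x)%:E].

Lemma is_density_dominates p q h : is_density p q h -> p `<< q.
Proof.
move=> [mh h0 pE]; apply/null_content_dominatesP => A mA qA0.
by rewrite pE// null_set_integral//; exact/measurable_EFinP/measurable_funTS.
Qed.

Lemma exists_density p (q : probability T R) : p `<< q -> exists h, is_density p q h.
Proof.
move=> pq; pose f := Radon_Nikodym_SigmaFinite.f p q.
have ffin x : f x \is a fin_num by exact: Radon_Nikodym_SigmaFinite.f_fin_num.
have fE : EFin \o (fine \o f) = f by apply/funext => x /=; rewrite fineK.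
have mf := measurable_int _ (Radon_Nikodym_SigmaFinite.f_integrable pq).
exists (fine \o f); split.
- by apply/measurable_EFinP; rewrite fE.
- by move=> x; rewrite fine_ge0// Radon_Nikodym_SigmaFinite.f_ge0.
- move=> A mA; rewrite (Radon_Nikodym_SigmaFinite.f_integral pq)//.
  by apply: eq_integral => x _ /=; rewrite fineK.
Qed.

Lemma ge0_integral_density p q h (f : T -> \bar R) : is_density p q h ->
  measurable_fun setT f -> (forall x, 0 <= f x) ->
  \int[p]_x f x = \int[q]_x (f x * (h x)%:E).
Proof.
move=> ph mf f0; have pq := is_density_dominates ph; have [mh h0 pE] := ph.
have mr := measurable_int _ (Radon_Nikodym_SigmaFinite.f_integrable pq).
rewrite -(Radon_Nikodym_SigmaFinite.change_of_variables pq)//.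
have mh' : measurable_fun setT (EFin \o h) by exact/measurable_EFinP.
apply: ge0_ae_eq_integral => //.
- exact: emeasurable_funM.
- exact: emeasurable_funM.
- by move=> x _; rewrite mule_ge0// Radon_Nikodym_SigmaFinite.f_ge0.
- by move=> x _; rewrite mule_ge0// lee_fin.
have : ae_eq q setT (Radon_Nikodym_SigmaFinite.f p q) (EFin \o h).
  apply: integral_ae_eq => //.
    exact: Radon_Nikodym_SigmaFinite.f_integrable.
  move=> E _ mE; rewrite -(Radon_Nikodym_SigmaFinite.f_integral pq)//.
  by rewrite -pE.
by apply: filterS => x /= /(_ I) ->.
Qed.

Lemma measurable_lne h : measurable_fun setT h ->
  measurable_fun setT (fun x => lne (h x)%:E).
Proof.
move=> mh; rewrite (_ : (fun x => _) =
    fun x => if (h x <= 0)%R then -oo else (ln (h x))%:E) //.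
apply: measurable_fun_ifT => //.
- exact: measurable_fun_ler.
- apply/measurable_EFinP; exact: measurableT_comp.
Qed.

(** Densities agree [q]-almost everywhere, hence [p]-almost everywhere by domination, so any of them
    computes the divergence. *)
Lemma KL_density p (q : probability T R) h : is_density p q h ->
  KL p q = \int[p]_x lne (h x)%:E.
Proof.
move=> ph; have pq := is_density_dominates ph; have [mh h0 pE] := ph.
rewrite /KL asboolT//.
have pq' : charge_of_finite_measure p `<< q by exact: pq.
have irn := Radon_Nikodym_integrable pq'.
have rnh : ae_eq q setT (Radon_Nikodym (charge_of_finite_measure p) q)
    (EFin \o h).
  apply: integral_ae_eq => //; first exact/measurable_EFinP.
  by move=> E _ mE; rewrite -(Radon_Nikodym_integral pq')//=; exact: pE.
have {rnh} rnh := null_dominates_ae_eq measurableT pq rnh.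
apply: ae_eq_integral => //.
- pose k := fine \o Radon_Nikodym (charge_of_finite_measure p) q.
  rewrite (_ : (fun x => _) = fun x => lne (k x)%:E); last first.
    by apply/funext => x; rewrite /k /comp fineK// Radon_Nikodym_fin_num.
  apply: measurable_lne; apply/measurable_EFinP.
  rewrite (_ : _ \o _ = Radon_Nikodym (charge_of_finite_measure p) q).
    exact: measurable_int irn.
  by apply/funext => x; rewrite /k /comp fineK// Radon_Nikodym_fin_num.
- exact: measurable_lne.
- by apply: filterS rnh => x /= /(_ I) ->.
Qed.

Lemma is_density_gt0 p q h : is_density p q h -> {ae p, forall x, (0 < h x)%R}.
Proof.
move=> ph; have [mh h0 pE] := ph.
have mA : measurable [set x | h x = 0%R].
  by rewrite -[X in measurable X]setTI; exact: (mh measurableT [set 0%R]).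
exists [set x | h x = 0%R]; split => //.
  rewrite pE// (eq_integral (cst 0)) ?integral0// => x.
  by rewrite inE /= => ->.
by move=> x /= /negP; rewrite lt_neqAle h0 andbT negbK eq_sym => /eqP.
Qed.

End density.

Section integral_lemmas.
Local Open Scope ereal_scope.
Context {R : realType} d {T : measurableType d}.

(** Positive and negative parts are compared separately, so infinite integrals are covered. *)
Lemma ae_le_integral (mu : {measure set T -> \bar R}) (f g : T -> \bar R) :
  measurable_fun setT f -> measurable_fun setT g ->
  {ae mu, forall x, f x <= g x} -> \int[mu]_x f x <= \int[mu]_x g x.
Proof.
move=> mf mg fg; rewrite integralE [leRHS]integralE; apply: leeB.
- apply: ae_ge0_le_integral => //; try exact: measurable_funepos.
  apply: filterS fg => x fgx _; rewrite !funeposE.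
  by rewrite ge_max !le_max fgx lexx orbT.
- apply: ae_ge0_le_integral => //; try exact: measurable_funeneg.
  apply: filterS fg => x fgx _; rewrite !funenegE.
  by rewrite ge_max !le_max leeN2 fgx lexx orbT.
Qed.

Lemma ge0_measurable_funV (h : T -> R) : measurable_fun setT h ->
  (forall x, (0 <= h x)%R) -> measurable_fun setT (fun x => (h x)^-1)%R.
Proof.
(* Where [h] vanishes, the convention [0^-1 = 0] gives the first branch. *)
move=> mh h0; rewrite (_ : (fun x => _) =
    fun x => if (h x <= 0)%R then 0%R else expR (- ln (h x))); last first.
  apply/funext => x; case: ifPn => [hx|]; last first.
    by rewrite -ltNge => hx; rewrite expRN lnK.
  have /eqP -> : h x == 0%R by rewrite eq_le hx h0.
  by rewrite invr0.
apply: measurable_fun_ifT => //; first exact: measurable_fun_ler.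
apply: measurableT_comp => //; apply: measurableT_comp => //.
exact: measurableT_comp.
Qed.

End integral_lemmas.

Section image.
Local Open Scope ereal_scope.
Context {R : realType} d1 d2 {T1 : measurableType d1} {T2 : measurableType d2}.

Lemma integral_image (p : probability T1 R) (p' : probability T2 R)
    (f : T1 -> T2) (F : T2 -> \bar R) :
  measurable_fun setT f ->
  (forall A, measurable A -> p' A = p (f @^-1` A)) ->
  measurable_fun setT F -> \int[p']_y F y = \int[p]_x F (f x).
Proof.
move=> mf p'E mF.
pose f_mixin := isMeasurableFun.Build _ _ _ _ f mf.
pose fm : {mfun T1 >-> T2} := HB.pack f f_mixin.
have -> : \int[p']_y F y = \int[distribution p fm]_y F y.
  by apply: eq_measure_integral => A mA _; exact: p'E.
rewrite integralE [RHS]integralE; congr (_ - _).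
- rewrite ge0_integral_distribution//; last exact: measurable_funepos.
  by rewrite -funepos_comp.
- rewrite ge0_integral_distribution//; last exact: measurable_funeneg.
  by rewrite -funeneg_comp.
Qed.

End image.

(** * Gibbs' inequality and the data-processing inequality *)

Section data_processing.
Local Open Scope ereal_scope.
Context {R : realType} d {T : measurableType d}.
Implicit Types (p q : probability T R) (h : T -> R).

(** Multiplying [u / h] by the density [h] restores [u] except where [h = 0]; the mass of [u] there
    is lost, hence an inequality. *)
Lemma integral_density_div_le p q h (u : T -> R) : is_density p q h ->
  measurable_fun setT u -> (forall x, (0 <= u x)%R) ->
  \int[p]_x (u x / h x)%:E <= \int[q]_x (u x)%:E.
Proof.
move=> ph mu u0; have [mh h0 pE] := ph.
have mV : measurable_fun setT (fun x => (h x)^-1)%R.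
  exact: ge0_measurable_funV.
have muV : measurable_fun setT (fun x => u x / h x)%R.
  exact: measurable_funM.
rewrite (ge0_integral_density ph); first last.
- by move=> x; rewrite lee_fin divr_ge0.
- exact/measurable_EFinP.
apply: ge0_le_integral => //.
- by move=> x _; rewrite -EFinM lee_fin mulr_ge0// divr_ge0.
- by apply/measurable_EFinP; exact: measurable_funM.
- exact/measurable_EFinP.
- move=> x _; rewrite -EFinM lee_fin; have [->|hx] := eqVneq (h x) 0%R.
    by rewrite mulr0.
  by rewrite divfK.
Qed.

Lemma ln_le_ln_add (x y : R) : (0 < x)%R -> (0 < y)%R ->
  (ln x <= ln y + x / y - 1)%R.
Proof.
move=> x0 y0; have := @le_ln1Dx R (x / y - 1).
rewrite (_ : 1 + (x / y - 1) = x / y)%R; last by ring.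
rewrite ln_div ?posrE// => h.
have : (ln x - ln y <= x / y - 1)%R by apply: h; rewrite -subr_gt0 opprK subrK divr_gt0.
lra.
Qed.

(** Integrate the tangent inequality [ln u <= ln h + u / h - 1] against [p]: the last two terms
    contribute at most 0, since the [p]-integral of [u / h] is at most the [q]-integral of [u]. *)
Lemma gibbs p q h (u : T -> R) : is_density p q h ->
  measurable_fun setT u -> (forall x, (0 <= u x)%R) ->
  {ae p, forall x, (0 < u x)%R} -> \int[q]_x (u x)%:E <= 1 ->
  \int[p]_x lne (u x)%:E <= \int[p]_x lne (h x)%:E.
Proof.
move=> ph mu u0 up u1; have [mh h0 pE] := ph.
have hp := is_density_gt0 ph.
have mlh := measurable_lne mh.
have mlu := measurable_lne mu.
have mh1 : measurable_fun setT (fun x => (h x)^-1)%R.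
  exact: ge0_measurable_funV.
have muh : measurable_fun setT (fun x => u x / h x)%R by exact: measurable_funM.
(* The negative part of [ln h] is at most [1 / h], whose [p]-integral is at most 1. *)
have neg_fin : \int[p]_x (fun x => lne (h x)%:E)^\- x < +oo.
  apply: (@le_lt_trans _ _ (\int[p]_x (1 / h x)%:E)); last first.
    apply: (le_lt_trans (integral_density_div_le ph _ _)) => //.
    by rewrite integral_cst//= mul1e probability_setT ltry.
  apply: ae_ge0_le_integral => //.
  - exact: measurable_funeneg.
  - by move=> x _; rewrite lee_fin divr_ge0.
  - apply/measurable_EFinP; apply: measurable_funM => //.
  - apply: filterS hp => x hx _; rewrite funenegE lne_EFin// ge_max.
    rewrite -EFinN !lee_fin divr_ge0// andbT.
    have := ln_le_ln_add ltr01 hx; rewrite ln1; lra.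
(* If the positive part has infinite integral, the right-hand side is [+oo]. *)
have [pos_fin|] := boolP (\int[p]_x (fun x => lne (h x)%:E)^\+ x < +oo);
    last first.
  rewrite ltey negbK => /eqP pos_infty; rewrite [leRHS]integralE pos_infty.
  by rewrite addye ?leey// -ltNye lteNr.
have ih : p.-integrable setT (fun x => lne (h x)%:E).
  apply/integrableP; split => //.
  rewrite (eq_integral (fun x => (fun x => lne (h x)%:E)^\+ x +
      (fun x => lne (h x)%:E)^\- x)); last first.
    by move=> x _; rewrite -[LHS]/((abse \o (fun x => lne (h x)%:E)) x) fune_abse.
  rewrite ge0_integralD//.
  - by rewrite lte_add_pinfty.
  - exact: measurable_funepos.
  - exact: measurable_funeneg.
have iuh_le : \int[p]_x (u x / h x)%:E <= 1.
  exact: le_trans (integral_density_div_le ph mu u0) u1.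
have iuh : p.-integrable setT (fun x => (u x / h x)%:E).
  apply/integrableP; split; first exact/measurable_EFinP.
  rewrite (eq_integral (fun x => (u x / h x)%:E)).
    by apply: le_lt_trans iuh_le _; rewrite ltry.
  by move=> x _; rewrite gee0_abs// lee_fin divr_ge0.
have i1 : p.-integrable setT (cst 1%:E : T -> \bar R).
  by apply: finite_measure_integrable_cst.
have ihuh := integrableD measurableT ih iuh.
have ilu : \int[p]_x lne (u x)%:E <=
    \int[p]_x ((lne (h x)%:E + (u x / h x)%:E) - cst 1%:E x).
  apply: ae_le_integral => //.
    by apply: measurable_int; exact: (integrableB measurableT ihuh i1).
  apply: filterS2 hp up => x hx ux.
  rewrite !lne_EFin//= -EFinD lee_fin.
  by have := ln_le_ln_add ux hx; lra.
apply: (le_trans ilu).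
rewrite integralB// integralD// integral_cst//= probability_setT mul1e.
rewrite leeBlDr// leeD2l//.
Qed.

End data_processing.

Section data_processing2.
Local Open Scope ereal_scope.
Context {R : realType} d1 d2 {T1 : measurableType d1} {T2 : measurableType d2}.
Variables (p q : probability T1 R) (p' q' : probability T2 R) (f : T1 -> T2).
Hypothesis mf : measurable_fun setT f.
Hypothesis p'E : forall A, measurable A -> p' A = p (f @^-1` A).
Hypothesis q'E : forall A, measurable A -> q' A = q (f @^-1` A).

(** Gibbs' inequality for [u = g \o f], with [g] the density of the image measures: by change of
    variables [u] has [q]-integral 1, and the integral of its logarithm against [p] is
    [KL p' q']. *)
Lemma data_processing : KL p' q' <= KL p q.
Proof.
have mfA A : measurable A -> measurable (f @^-1` A).
  by move=> mA; rewrite -[X in measurable X]setTI; exact: mf.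
have [pq|npq] := pselect (p `<< q); last by rewrite /KL (asboolF npq) leey.
have p'q' : p' `<< q'.
  apply/null_content_dominatesP => A mA qA0; rewrite p'E//.
  move/null_content_dominatesP : pq; apply; first exact: mfA.
  exact: etrans (esym (q'E mA)) qA0.
have [h ph] := exists_density pq.
have [g p'g] := exists_density p'q'.
have [mg g0 gE] := p'g.
rewrite (KL_density ph) (KL_density p'g).
rewrite (integral_image mf p'E); last exact: measurable_lne.
have mgf : measurable_fun setT (g \o f) by exact: measurableT_comp.
apply: (gibbs ph mgf) => /=.
- by move=> x; exact: g0.
- have [N [mN N0 gN]] := is_density_gt0 p'g.
  exists (f @^-1` N); split; [exact: mfA|by rewrite -p'E|].
  by move=> x /= gx; exact: gN.
- rewrite -(@integral_image _ _ _ _ _ _ _ f (EFin \o g) mf q'E).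
    by rewrite -gE// probability_setT.
  exact/measurable_EFinP.
Qed.

End data_processing2.

Section of_density.
Local Open Scope ereal_scope.
Context {R : realType} d {T : measurableType d}.

Lemma exists_probability_density (q : probability T R) (h : T -> R) :
  measurable_fun setT h -> (forall x, (0 <= h x)%R) ->
  \int[q]_x (h x)%:E = 1 -> exists p : probability T R, is_density p q h.
Proof.
move=> mh h0 h1.
pose m (A : set T) := \int[q]_(x in A) (h x)%:E.
have mE : measurable_fun setT (EFin \o h) by exact/measurable_EFinP.
have m0 : m set0 = 0 by rewrite /m integral_set0.
have mge0 A : 0 <= m A by apply: integral_ge0 => x _; rewrite lee_fin.
have ih : q.-integrable setT (EFin \o h).
  apply/integrableP; split => //.
  rewrite (eq_integral (fun x => (h x)%:E)) ?h1 ?ltry// => x _ /=.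
  by rewrite ger0_norm.
have msa : semi_sigma_additive m.
  move=> /= A mA tA mUA; rewrite /m integral_bigcup//; last first.
    exact: integrableS ih.
  apply: is_cvg_ereal_nneg_natsum_cond => n _ _.
  by apply: integral_ge0 => x _; rewrite lee_fin.
pose m_mixin := isMeasure.Build _ _ _ m m0 mge0 msa.
pose mm : {measure set T -> \bar R} := HB.pack m m_mixin.
have m1 : mm setT = 1 by [].
pose p_mixin := Measure_isProbability.Build _ _ _ mm m1.
pose p : probability T R := HB.pack m m_mixin p_mixin.
by exists p; split.
Qed.

End of_density.

(** * Images and lifts of couplings under product maps *)

Section product.
Local Open Scope ereal_scope.
Context {R : realType} d1 d2 {T1 : measurableType d1} {T2 : measurableType d2}.
Variables (q1 : probability T1 R) (q2 : probability T2 R) (h : T1 * T2 -> R).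
Hypotheses (mh : measurable_fun setT h) (h0 : forall z, (0 <= h z)%R).

Lemma ge0_fubini_strip1 (A : set T1) : measurable A ->
  \int[q1 \x q2]_(z in A `*` setT) (h z)%:E =
  \int[q1]_(x in A) \int[q2]_y (h (x, y))%:E.
Proof.
move=> mA; rewrite integral_mkcond [RHS]integral_mkcond fubini_tonelli1//.
- apply: eq_integral => x _; rewrite /fubini_F /patch/=.
  have [xA|xA] := boolP (x \in A).
    apply: eq_integral => y _; rewrite ifT// inE/=; split=> //.
    by rewrite inE in xA.
  rewrite (eq_integral (cst 0)) ?integral0// => y _; rewrite ifF//.
  by apply/negbTE; apply: contra xA; rewrite !inE => -[].
- apply/(measurable_restrictT _ _).1; first exact: measurableX.
  exact/measurable_funTS/measurable_EFinP.
- by move=> z; rewrite /patch; case: ifP; rewrite // lee_fin.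
Qed.

Lemma ge0_fubini_strip2 (A : set T2) : measurable A ->
  \int[q1 \x q2]_(z in setT `*` A) (h z)%:E =
  \int[q2]_(y in A) \int[q1]_x (h (x, y))%:E.
Proof.
move=> mA; rewrite integral_mkcond [RHS]integral_mkcond fubini_tonelli2//.
- apply: eq_integral => y _; rewrite /fubini_G /patch/=.
  have [xA|xA] := boolP (y \in A).
    apply: eq_integral => x _; rewrite ifT// inE/=; split=> //.
    by rewrite inE in xA.
  rewrite (eq_integral (cst 0)) ?integral0// => x _; rewrite ifF//.
  by apply/negbTE; apply: contra xA; rewrite !inE => -[].
- apply/(measurable_restrictT _ _).1; first exact: measurableX.
  exact/measurable_funTS/measurable_EFinP.
- by move=> z; rewrite /patch; case: ifP; rewrite // lee_fin.
Qed.

End product.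

Section image_product.
Local Open Scope ereal_scope.
Context {R : realType} d1 d2 {Z : measurableType d1} {X : measurableType d2}.

(** The assumption forces [F = 1] almost everywhere for [mu], hence [F \o S = 1] almost everywhere
    for [g]. Applied to marginal densities, it gives the marginals of a lifted coupling. *)
Lemma integral_image_one (g : probability Z R) (mu : probability X R)
    (S : Z -> X) (F : X -> \bar R) : measurable_fun setT S ->
  (forall A, measurable A -> mu A = g (S @^-1` A)) ->
  measurable_fun setT F ->
  (forall A, measurable A -> \int[mu]_(x in A) F x = mu A) ->
  forall A, measurable A -> \int[g]_(z in A) F (S z) = g A.
Proof.
move=> mS muE mF F1 A mA.
have F1ae : ae_eq mu setT (cst 1) F.
  apply: integral_ae_eq => //.
    exact: finite_measure_integrable_cst.
  by move=> E _ mE; rewrite F1// integral_cst// mul1e.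
rewrite -[RHS]mul1e -integral_cst//.
apply: ae_eq_integral => //.
  by apply: measurable_funTS; exact: measurableT_comp.
have [N [mN N0 FN]] := F1ae.
exists (S @^-1` N); split.
- by rewrite -[X in measurable X]setTI; exact: mS.
- exact: etrans (esym (muE _ mN)) N0.
- move=> z /= Hz; apply: FN => /= Fz; apply: Hz => _.
  by rewrite -Fz.
Qed.

Variables (g1 g2 : probability Z R) (mu nu : probability X R) (S T : Z -> X).
Hypotheses (mS : measurable_fun setT S) (mT : measurable_fun setT T).
Hypothesis muE : forall A, measurable A -> mu A = g1 (S @^-1` A).
Hypothesis nuE : forall A, measurable A -> nu A = g2 (T @^-1` A).

Definition pair_map (z : Z * Z) : X * X := (S z.1, T z.2).

Lemma measurable_pair_map : measurable_fun setT pair_map.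
Proof.
apply/measurable_fun_pairP; split; rewrite /comp/=.
- by apply: (measurableT_comp mS); exact: measurable_fst.
- by apply: (measurableT_comp mT); exact: measurable_snd.
Qed.

Lemma product_image A : measurable A ->
  (mu \x nu) A = (g1 \x g2) (pair_map @^-1` A).
Proof.
move=> mA.
pose f_mixin := isMeasurableFun.Build _ _ _ _ pair_map measurable_pair_map.
pose fm : {mfun (Z * Z)%type >-> (X * X)%type} := HB.pack pair_map f_mixin.
have mSA B : measurable B -> measurable (S @^-1` B).
  by move=> mB; rewrite -[X in measurable X]setTI; exact: mS.
have mTA B : measurable B -> measurable (T @^-1` B).
  by move=> mB; rewrite -[X in measurable X]setTI; exact: mT.
apply: (product_measure_unique (m' := distribution (g1 \x g2)%E fm)) => //.
move=> B C mB mC.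
transitivity (g1 (S @^-1` B) * g2 (T @^-1` C)).
  exact: (product_measure1E g1 g2 (mSA _ mB) (mTA _ mC)).
by congr (_ * _); [exact/esym/muE|exact/esym/nuE].
Qed.

Lemma coupling_image (p : probability (Z * Z)%type R) : couplings g1 g2 p ->
  exists2 p', couplings mu nu p' &
    forall A, measurable A -> p' A = p (pair_map @^-1` A).
Proof.
move=> cp.
pose f_mixin := isMeasurableFun.Build _ _ _ _ pair_map measurable_pair_map.
pose fm : {mfun (Z * Z)%type >-> (X * X)%type} := HB.pack pair_map f_mixin.
exists (distribution p fm) => // A mA.
have mSA : measurable (S @^-1` A).
  by rewrite -[X in measurable X]setTI; exact: mS.
have mTA : measurable (T @^-1` A).
  by rewrite -[X in measurable X]setTI; exact: mT.
by rewrite muE// nuE// -(cp _ mSA).1 -(cp _ mTA).2.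
Qed.

(* The density of [p'] is that of [p] composed with [pair_map]. *)
Lemma coupling_lift (p : probability (X * X)%type R) :
  couplings mu nu p -> p `<< (mu \x nu) ->
  exists p' : probability (Z * Z)%type R,
    [/\ couplings g1 g2 p', KL p' (g1 \x g2) = KL p (mu \x nu)
      & forall A, measurable A -> p A = p' (pair_map @^-1` A)].
Proof.
move=> cp pmn; have [h ph] := exists_density pmn.
have [mh h0 pE] := ph; have mf := measurable_pair_map.
have mhf : measurable_fun setT (h \o pair_map) by exact: measurableT_comp.
have mhE : measurable_fun setT (EFin \o h) by exact/measurable_EFinP.
have h1 : \int[g1 \x g2]_z (h (pair_map z))%:E = 1.
  rewrite -(integral_image (F := EFin \o h) mf product_image)//.
  by rewrite -pE// probability_setT.
have [p' p'h] := exists_probability_density mhf (fun z => h0 (pair_map z)) h1.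
have [_ _ p'E] := p'h.
have imE A : measurable A -> p A = p' (pair_map @^-1` A).
  move=> mA; rewrite p'E//; last first.
    by rewrite -[X in measurable X]setTI; exact: mf.
  rewrite pE// integral_mkcond [RHS]integral_mkcond.
  rewrite (integral_image mf product_image).
    by apply: eq_integral => z _; rewrite /patch/=.
  apply/(measurable_restrictT _ _).1 => //; exact: measurable_funTS.
exists p'; split=> //; last first.
  rewrite (KL_density p'h) (KL_density ph) (integral_image mf imE)//.
  exact: measurable_lne.
move=> A mA; split.
- rewrite p'E; last exact: measurableX.
  rewrite ge0_fubini_strip1//; last by move=> z; exact: h0.
  (* The first marginal of [p'] has density [F \o S], where [F] is the marginal density of [p]; the
     last bullet checks that [F] integrates like 1 because [p] is a coupling. *)
  rewrite -(integral_image_one (F := fun x => \int[nu]_y (h (x, y))%:E) mS muE)//.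
  + apply: eq_integral => x _ /=.
    rewrite (integral_image mT nuE)//.
    by apply/measurable_EFinP; exact: measurableT_comp.
  + by apply: (measurable_fun_fubini_tonelli_F (EFin \o h) mhE) => z; rewrite lee_fin.
  + move=> B mB; rewrite -(cp B mB).1 pE; last exact: measurableX.
    by rewrite ge0_fubini_strip1.
- rewrite p'E; last exact: measurableX.
  rewrite ge0_fubini_strip2//; last by move=> z; exact: h0.
  rewrite -(integral_image_one (F := fun y => \int[mu]_x (h (x, y))%:E) mT nuE)//.
  + apply: eq_integral => x _ /=.
    rewrite (integral_image mS muE)//.
    by apply/measurable_EFinP; exact: measurableT_comp.
  + by apply: (measurable_fun_fubini_tonelli_G (EFin \o h) mhE) => z; rewrite lee_fin.
  + move=> B mB; rewrite -(cp B mB).2 pE; last exact: measurableX.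
    by rewrite ge0_fubini_strip2.
Qed.

End image_product.

(** * Comparison of entropic costs through a common reference measure *)

Section OT_compare.
Local Open Scope ereal_scope.
Context {R : realType} d (Z : measurableType d) (n : nat).
Variables (g : probability Z R) (eps : R).
Hypothesis eps0 : (0 < eps)%R.

Lemma measurable_sqdist :
  measurable_fun setT (fun z : euclid R n * euclid R n => sqdist z.1 z.2).
Proof.
apply: measurable_sum => i; apply: measurable_funX; apply: measurable_funB.
- by apply: (measurableT_comp (measurable_tnth i)); exact: measurable_fst.
- by apply: (measurableT_comp (measurable_tnth i)); exact: measurable_snd.
Qed.

Lemma sqdist_ge0 (x y : euclid R n) : (0 <= sqdist x y)%R.
Proof. by apply: sumr_ge0 => i _; exact: sqr_ge0. Qed.

(** A plan for [mu], [nu] is lifted with unchanged divergence, then pushed by [S'] and [T'] to a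
    plan for [mu'], [nu'] with no larger divergence. Only transport costs over couplings of [g] with
    itself remain to be compared. *)
Lemma OT_compare (mu nu mu' nu' : probability (euclid R n) R)
    (S T S' T' : Z -> euclid R n) (delta : R) :
  measurable_fun setT S -> measurable_fun setT T ->
  measurable_fun setT S' -> measurable_fun setT T' ->
  (forall A, measurable A -> mu A = g (S @^-1` A)) ->
  (forall A, measurable A -> nu A = g (T @^-1` A)) ->
  (forall A, measurable A -> mu' A = g (S' @^-1` A)) ->
  (forall A, measurable A -> nu' A = g (T' @^-1` A)) ->
  (forall p, couplings g g p ->
    \int[p]_z (sqdist (S' z.1) (T' z.2))%:E <=
    \int[p]_z (sqdist (S z.1) (T z.2))%:E + delta%:E) ->
  OT eps mu' nu' <= OT eps mu nu + delta%:E.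
Proof.
move=> mS mT mS' mT' muE nuE mu'E nu'E le_cost.
rewrite -leeBlDr//; apply: le_ereal_inf_tmp => _ [p cp <-].
rewrite leeBlDr//.
have msq := measurable_sqdist.
(* A plan that is not dominated has infinite cost, and cannot be lifted through a density. *)
have [pmn|npmn] := pselect (p `<< (mu \x nu)); last first.
  rewrite /KL asboolF// gt0_muley ?lte_fin// addey ?addye ?leey//.
  rewrite gt_eqF// (@lt_le_trans _ _ 0)//.
  by apply: integral_ge0 => z _; rewrite lee_fin sqdist_ge0.
have [q [cq KLq pE]] := coupling_lift mS mT muE nuE cp pmn.
have [p' cp' p'E] := coupling_image mS' mT' mu'E nu'E cq.
apply: ge_ereal_inf.
eexists; first by exists p'.
rewrite (integral_image (measurable_pair_map mS' mT') p'E); last first.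
  exact/measurable_EFinP.
rewrite (integral_image (measurable_pair_map mS mT) pE); last first.
  exact/measurable_EFinP.
rewrite [leRHS]addeAC. rewrite leeD//; [exact: le_cost|].
rewrite lee_pmul2l// -KLq.
apply: (data_processing (measurable_pair_map mS' mT') p'E).
move=> A mA; exact: product_image.
Qed.

End OT_compare.

(** * Gaussian measures *)

Section standard_gaussian_moments.
Local Open Scope ereal_scope.
Context {R : realType}.

Lemma is_density_normal (m s : R) :
  is_density (normal_prob m s) lebesgue_measure (normal_pdf m s).
Proof.
split=> //; first exact: measurable_normal_pdf.
by move=> x; exact: normal_pdf_ge0.
Qed.

(* The density of [N(m, s^2)] relative to [N(0, 1)] is the exponential of a
   quadratic polynomial, so that [1 + u <= expR u] bounds second moments. The
   mean and the variance are chosen for [u] to be a multiple of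
   [(c * x + b) ^+ 2] up to a constant. *)
Lemma normal_pdf_quadratic_le (c b w x : R) : (0 < w)%R -> (c != 0)%R ->
  let s := Num.sqrt (1 + w) in
  (normal_pdf 0 1 x * (1 + w / (2 * c ^+ 2 * (1 + w)) * (c * x + b) ^+ 2) <=
  s * normal_pdf (w * b / c) s x + w * b ^+ 2 / (2 * c ^+ 2) * normal_pdf 0 1 x)%R.
Proof.
move=> w0 c0 /=; set s := Num.sqrt (1 + w).
have s0 : (0 < s)%R by rewrite sqrtr_gt0; lra.
have s2 : (s ^+ 2 = 1 + w)%R by rewrite sqr_sqrtr//; lra.
rewrite !normal_pdfE ?oner_neq0 ?gt_eqF//.
have -> : (s * (normal_peak s * normal_fun (w * b / c) s x) =
  normal_peak 1 * normal_fun (w * b / c) s x)%R.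
  rewrite mulrA; congr (_ * _)%R; rewrite /normal_peak expr1n mul1r.
  rewrite -mulrnAr sqrtrM ?sqr_ge0// sqrtr_sqr gtr0_norm// invfM mulrA.
  by rewrite divff ?gt_eqF// mul1r.
have -> : normal_fun (w * b / c) s x = (normal_fun 0 1 x *
    expR (w / (2 * c ^+ 2 * (1 + w)) * (c * x + b) ^+ 2
      - w * b ^+ 2 / (2 * c ^+ 2)))%R.
  rewrite /normal_fun -expRD s2; congr expR.
  by field; rewrite c0 /= gt_eqF//; lra.
set u := (_ - _)%R; have := expR_ge1Dx u.
set N := (normal_peak 1 * normal_fun 0 1 x)%R => hu.
have N0 : (0 <= N)%R by rewrite mulr_ge0 ?normal_peak_ge0 ?normal_fun_ge0.
rewrite [(normal_peak 1 * (_ * expR u))%R]mulrA -/N.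
rewrite -lerBlDr [X in (_ - X)%R]mulrC -mulrBr ler_wpM2l//.
by rewrite (le_trans _ hu)// /u; lra.
Qed.

Lemma normal_second_moment (c b : R) :
  \int[normal_prob 0 1]_x ((c * x + b) ^+ 2)%:E <= (c ^+ 2 + b ^+ 2)%:E.
Proof.
have [->|c0] := eqVneq c 0%R.
  rewrite (eq_integral (cst (b ^+ 2)%:E)); last first.
    by move=> x _; rewrite mul0r add0r.
  by rewrite integral_cst//= probability_setT mule1 expr0n/= add0r.
have c20 : (0 < c ^+ 2)%R by rewrite exprn_even_gt0.
set I := \int[_]_x _.
(* Here [w] is the excess variance of the comparison density; it is sent to 0. *)
suff H (w : R) : (0 < w)%R -> I <= ((1 + w) * (c ^+ 2 + b ^+ 2))%:E.
  apply/lee_addgt0Pr => e e0.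
  pose K := (c ^+ 2 + b ^+ 2)%R; have K0 : (0 < K)%R by rewrite ltr_wpDr ?sqr_ge0.
  apply: le_trans (H (e / K)%R (divr_gt0 e0 K0)) _.
  by rewrite -EFinD lee_fin -/K mulrDl mul1r divfK ?gt_eqF.
move=> w0; pose s := Num.sqrt (1 + w).
have s1 : (1 <= s)%R by rewrite -[leLHS]sqrtr1 ler_sqrt; lra.
have s2 : (s ^+ 2 = 1 + w)%R by rewrite sqr_sqrtr//; lra.
have mq : measurable_fun setT (fun x : R => (c * x + b) ^+ 2)%R.
  by apply: measurable_funX; apply: measurable_funD.
pose k := (w / (2 * c ^+ 2 * (1 + w)))%R.
have k0 : (0 < k)%R by rewrite divr_gt0// mulr_gt0 ?addr_gt0// mulr_gt0.
pose l := (w * b ^+ 2 / (2 * c ^+ 2))%R.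
have l0 : (0 <= l)%R.
  by rewrite divr_ge0// mulr_ge0 ?sqr_ge0// ltW.
have : 1 + k%:E * I <= (s + l)%:E.
  have -> : 1 + k%:E * I =
      \int[lebesgue_measure]_x (normal_pdf 0 1 x * (1 + k * (c * x + b) ^+ 2))%:E.
    transitivity (\int[normal_prob 0 1]_x (1 + k * (c * x + b) ^+ 2)%:E).
      under [RHS]eq_integral do rewrite EFinD EFinM.
      rewrite ge0_integralD//.
      - rewrite integral_cst//= probability_setT mul1e ge0_integralZl//.
        + exact/measurable_EFinP.
        + by move=> x _; rewrite lee_fin sqr_ge0.
        + by rewrite lee_fin ltW.
      - by move=> x _; rewrite -EFinM lee_fin mulr_ge0 ?sqr_ge0 ?ltW.
      - by apply/measurable_EFinP; exact: measurable_funM.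
    rewrite (ge0_integral_density (is_density_normal 0 1)).
    - by apply: eq_integral => x _; rewrite -EFinM mulrC.
    - by apply/measurable_EFinP/measurable_funD => //; exact: measurable_funM.
    - by move=> x; rewrite lee_fin addr_ge0// mulr_ge0 ?sqr_ge0 ?ltW.
  have -> : (s + l)%:E = \int[lebesgue_measure]_x
      (s * normal_pdf (w * b / c) s x + l * normal_pdf 0 1 x)%:E.
    under eq_integral do rewrite EFinD (EFinM s) (EFinM l).
    rewrite ge0_integralD//.
    - rewrite !ge0_integralZl// ?lee_fin//.
      + by rewrite !integral_normal_pdf !mule1.
      + exact: measurable_int (integrable_normal_pdf _ _).
      + by move=> x _; rewrite lee_fin normal_pdf_ge0.
      + exact: le_trans s1.
      + exact: measurable_int (integrable_normal_pdf _ _).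
      + by move=> x _; rewrite lee_fin normal_pdf_ge0.
    - by move=> x _; rewrite -EFinM lee_fin mulr_ge0 ?normal_pdf_ge0//; lra.
    - apply: measurable_funeM.
      exact: measurable_int (integrable_normal_pdf _ _).
    - by move=> x _; rewrite -EFinM lee_fin mulr_ge0 ?normal_pdf_ge0.
    - apply: measurable_funeM.
      exact: measurable_int (integrable_normal_pdf _ _).
  apply: ge0_le_integral => //.
  - move=> x _; rewrite lee_fin mulr_ge0 ?normal_pdf_ge0// addr_ge0//.
    by rewrite mulr_ge0 ?sqr_ge0 ?ltW.
  - apply/measurable_EFinP/measurable_funM; first exact: measurable_normal_pdf.
    by apply: measurable_funD => //; exact: measurable_funM.
  - by apply/measurable_EFinP/measurable_funD; apply: measurable_funM => //;
      exact: measurable_normal_pdf.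
  - move=> x _; rewrite lee_fin; exact: normal_pdf_quadratic_le.
have I0 : 0 <= I by apply: integral_ge0 => x _; rewrite lee_fin sqr_ge0.
(* An infinite moment would contradict the finite bound [s + l]. *)
have [->|] := eqVneq I +oo; first by rewrite gt0_muley ?lte_fin// addey.
move: I I0 => [r| |]// r0 _; rewrite -EFinM -EFinD !lee_fin => h.
have : (k * r <= s - 1 + l)%R by lra.
rewrite -ler_pdivlMl// => /le_trans; apply.
have -> : (k^-1 * (s - 1 + l) =
    2 * c ^+ 2 * (1 + w) * ((s - 1) / w) + (1 + w) * b ^+ 2)%R.
  by rewrite /k /l; field; rewrite c0 !gt_eqF//; lra.
rewrite [leRHS]mulrDr lerD2r.
rewrite (_ : _ * _ = (1 + w) * c ^+ 2 * (2 * (s - 1) / w))%R; last by field; lra.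
apply: ler_piMr; first by rewrite mulr_ge0 ?sqr_ge0//; lra.
rewrite ler_pdivrMr// mul1r.
(* As [s >= 1], this factorization gives [2 * (s - 1) <= w]. *)
have -> : w = ((s - 1) * (s + 1))%R by rewrite -subr_sqr_1 s2; lra.
by rewrite mulrC ler_wpM2l; lra.
Qed.

End standard_gaussian_moments.

Section std_gaussian_moments.
Local Open Scope ereal_scope.
Context {R : realType}.

Lemma measurable_linear_form n (c : 'I_n -> R) (b : R) :
  measurable_fun setT (fun z : euclid R n => \sum_i c i * tnth z i + b)%R.
Proof.
apply: measurable_funD => //; apply: measurable_sum => i.
by apply: measurable_funM => //; exact: measurable_tnth.
Qed.

(** The offset [b] makes the induction go through: while the first coordinate is integrated, the
    rest of the linear form acts as an offset. *)
Lemma std_gaussian_second_moment n (c : 'I_n -> R) (b : R) :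
  \int[std_gaussian n]_z ((\sum_i c i * tnth z i + b) ^+ 2)%:E <=
  (\sum_i c i ^+ 2 + b ^+ 2)%:E.
Proof.
elim: n c b => [|n IH] c b.
  rewrite integral_dirac// ?diracT ?mul1e ?big_ord0 ?add0r//.
  by apply/measurable_EFinP/measurable_funX; exact: measurable_linear_form.
have mF : measurable_fun setT
    (fun z : euclid R n.+1 => ((\sum_i c i * tnth z i + b) ^+ 2)%:E).
  by apply/measurable_EFinP/measurable_funX; exact: measurable_linear_form.
rewrite /= ge0_integral_distribution//; last first.
  by move=> z; rewrite lee_fin sqr_ge0.
rewrite fubini_tonelli2//; first last.
- by move=> z; rewrite lee_fin sqr_ge0.
- by apply: measurableT_comp mF _; exact: measurable_funP.
pose s (y : euclid R n) := (\sum_i c (lift ord0 i) * tnth y i + b)%R.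
have ms : measurable_fun setT (fun y => (s y ^+ 2)%:E).
  by apply/measurable_EFinP/measurable_funX; exact: measurable_linear_form.
have sE (y : euclid R n) (x : R) :
    (\sum_i c i * tnth (cons_vec (x, y)) i + b = c ord0 * x + s y)%R.
  rewrite big_ord_recl /= addrA tnth0; congr (_ + _ + _)%R.
  by apply: eq_bigr => i _; rewrite tnthS.
apply: (@le_trans _ _ (\int[std_gaussian n]_y ((c ord0 ^+ 2)%:E + (s y ^+ 2)%:E))).
  apply: ge0_le_integral => //.
  - by move=> y _; apply: integral_ge0 => x _; rewrite lee_fin sqr_ge0.
  - apply: measurable_fun_fubini_tonelli_G.
    + by apply: measurableT_comp mF _; exact: measurable_funP.
    + by move=> z; rewrite lee_fin sqr_ge0.
  - by apply: emeasurable_funD.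
  - move=> y _; rewrite -EFinD; apply: le_trans (normal_second_moment _ _).
    by rewrite /fubini_G/=; under eq_integral do rewrite sE.
rewrite ge0_integralD//; last 2 first.
- by move=> y _; rewrite lee_fin sqr_ge0.
- by move=> y _; rewrite lee_fin sqr_ge0.
rewrite integral_cst//= probability_setT mule1 big_ord_recl -addrA EFinD.
by rewrite leeD2l//; exact: IH.
Qed.

End std_gaussian_moments.

Section quadratic.
Context {R : realType}.

(** Replacing the scale [b] of [x] by [a] changes the form by a term in [x ^+ 2] and a cross term.
    The cross term is completed to a square, so that only weights on [x ^+ 2] and [y ^+ 2] are left,
    to be integrated against the marginals. *)
Lemma sqr_scale_diff_le (a b : R) : 0 <= a -> 0 <= b ->
  exists uv : R * R, [/\ 0 <= uv.1, 0 <= uv.2,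
    uv.1 + uv.2 <= 2 * `|a ^+ 2 - b ^+ 2| &
    forall x y, (a * x - b * y) ^+ 2 <=
                (b * x - b * y) ^+ 2 + uv.1 * x ^+ 2 + uv.2 * y ^+ 2].
Proof.
move=> a0 b0; have [ab|/ltW ba] := leP a b.
  exists (0, b ^+ 2 - a ^+ 2); split => //=.
  - by nra.
  - by rewrite add0r distrC ger0_norm; nra.
  - move=> x y; rewrite -subr_ge0.
    rewrite (_ : _ - _ = (b - a) * (b * (x - y) ^+ 2 + a * (x ^+ 2 + y ^+ 2)));
      last by ring.
    apply: mulr_ge0; first by rewrite subr_ge0.
    apply: addr_ge0; apply: mulr_ge0 => //; first exact: sqr_ge0.
    by apply: addr_ge0; exact: sqr_ge0.
(* These weights leave the gap [(a - b) * b * (x + y) ^+ 2]; their sum [(a - b) * (a + 3 * b)] is at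
   most [2 * (a ^+ 2 - b ^+ 2)] because [b <= a]. *)
exists ((a - b) * (a + 2 * b), (a - b) * b); split => /=.
- by rewrite mulr_ge0 ?subr_ge0//; lra.
- by rewrite mulr_ge0 ?subr_ge0//; lra.
- by rewrite ger0_norm; nra.
- move=> x y; rewrite -subr_ge0.
  rewrite (_ : _ - _ = (a - b) * b * (x + y) ^+ 2); last by ring.
  apply: mulr_ge0; last exact: sqr_ge0.
  by apply: mulr_ge0; rewrite ?subr_ge0.
Qed.

End quadratic.

(** * Sinkhorn divergence of centered Gaussians with a common eigenbasis *)

Section gaussian_sinkhorn.
Context {R : realType} (d : nat) (P : 'M[R]_d).
Hypothesis PtP : P^T *m P = 1%:M.
Implicit Types (a b : 'rV[R]_d) (z : euclid R d).

Definition eigencoord (i : 'I_d) z : R := \sum_j P j i * tnth z j.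

Lemma measurable_eigencoord i : measurable_fun setT (eigencoord i).
Proof.
by apply: measurable_sum => j; apply: measurable_funM => //;
  exact: measurable_tnth.
Qed.

Lemma sum_sqr_col_orth i : \sum_j P j i ^+ 2 = 1.
Proof.
have /matrixP/(_ i i) := PtP; rewrite !mxE eqxx mulr1n => <-.
by apply: eq_bigr => j _; rewrite !mxE expr2.
Qed.

Lemma std_gaussian_eigencoord i :
  (\int[std_gaussian d]_z (eigencoord i z ^+ 2)%:E <= 1)%E.
Proof.
have := std_gaussian_second_moment (P ^~ i) 0.
rewrite sum_sqr_col_orth expr0n addr0; apply: le_trans.
by rewrite le_eqVlt; apply/orP; left; apply/eqP/eq_integral => z _; rewrite addr0.
Qed.

Lemma sqdist_affine a b z z' :
  sqdist (affine_vec 0 (P *m diag_mx a *m P^T) z)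
         (affine_vec 0 (P *m diag_mx b *m P^T) z') =
  \sum_i (a 0 i * eigencoord i z - b 0 i * eigencoord i z') ^+ 2.
Proof.
(* The difference of the two images is [P *m w], and [P] preserves the norm. *)
pose w : 'cV[R]_d := \col_i (a 0 i * eigencoord i z - b 0 i * eigencoord i z').
have tE c y i : tnth (affine_vec 0 (P *m diag_mx c *m P^T) y) i =
    (P *m (\col_k (c 0 k * eigencoord k y))) i 0.
  rewrite tnth_mktuple mxE add0r.
  rewrite [RHS]mxE; under [RHS]eq_bigr do rewrite mxE mulrA mulr_sumr.
  rewrite exchange_big /=; apply: eq_bigr => j _; rewrite mxE mulr_suml.
  apply: eq_bigr => k _; rewrite mul_mx_diag !mxE; ring.
transitivity (((P *m w)^T *m (P *m w)) 0 0).
  rewrite mxE; apply: eq_bigr => i _.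
  rewrite [(P *m w)^T 0 i]mxE -expr2 !tE; congr (_ ^+ 2).
  by rewrite !mxE -sumrB; apply: eq_bigr => k _; rewrite !mxE mulrBr.
rewrite trmx_mul mulmxA -(mulmxA _ P^T) PtP mulmx1 mxE.
by apply: eq_bigr => i _; rewrite !mxE expr2.
Qed.

Lemma integral_coupling_fst (p : probability (euclid R d * euclid R d)%type R)
    (g1 g2 : probability (euclid R d) R) (F : euclid R d -> \bar R) :
  couplings g1 g2 p -> measurable_fun setT F ->
  (\int[p]_z F z.1 = \int[g1]_x F x)%E.
Proof.
move=> cp mF; rewrite (integral_image (f := fst) (p := p))//.
by move=> A mA; rewrite -(cp A mA).1; congr (p _); apply/seteqP; split => z //= [].
Qed.

Lemma integral_coupling_snd (p : probability (euclid R d * euclid R d)%type R)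
    (g1 g2 : probability (euclid R d) R) (F : euclid R d -> \bar R) :
  couplings g1 g2 p -> measurable_fun setT F ->
  (\int[p]_z F z.2 = \int[g2]_x F x)%E.
Proof.
move=> cp mF; rewrite (integral_image (f := snd) (p := p))//.
by move=> A mA; rewrite -(cp A mA).2; congr (p _); apply/seteqP; split => z //= [].
Qed.

Variables (eps : R) (eps0 : 0 < eps).

(** The error terms depend on one variable each, so every coupling integrates them through its
    standard Gaussian marginals, where eigencoordinates have second moment at most 1. *)
Lemma OT_gaussian_le (S T S' T' : 'M[R]_d) a b a' b' (u v : 'I_d -> R) :
  sqrtmx S = P *m diag_mx a *m P^T -> sqrtmx T = P *m diag_mx b *m P^T ->
  sqrtmx S' = P *m diag_mx a' *m P^T -> sqrtmx T' = P *m diag_mx b' *m P^T ->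
  (forall i, 0 <= u i) -> (forall i, 0 <= v i) ->
  (forall i x y, (a' 0 i * x - b' 0 i * y) ^+ 2 <=
     (a 0 i * x - b 0 i * y) ^+ 2 + u i * x ^+ 2 + v i * y ^+ 2) ->
  (OT eps (gaussian 0 S') (gaussian 0 T') <=
   OT eps (gaussian 0 S) (gaussian 0 T) + (\sum_i (u i + v i))%:E)%E.
Proof.
move=> SE TE S'E T'E u0 v0 le_uv.
have mA M : measurable_fun setT (affine_vec 0 M : euclid R d -> euclid R d).
  exact: measurable_funP.
apply: (OT_compare eps0 (mA (sqrtmx S)) (mA (sqrtmx T)) (mA (sqrtmx S'))
  (mA (sqrtmx T')) (g := std_gaussian d)) => // p cp.
rewrite SE TE S'E T'E.
have msq M N : measurable_fun setT
    (fun z : euclid R d * euclid R d => sqdist (affine_vec 0 M z.1) (affine_vec 0 N z.2)).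
  exact: (measurableT_comp (@measurable_sqdist R d)
    (measurable_pair_map (mA M) (mA N))).
have me1 i : measurable_fun setT
    (fun z : euclid R d * euclid R d => (u i)%:E * (eigencoord i z.1 ^+ 2)%:E)%E.
  apply/measurable_funeM/measurable_EFinP/measurable_funX.
  by apply: (measurableT_comp (measurable_eigencoord i)); exact: measurable_fst.
have me2 i : measurable_fun setT
    (fun z : euclid R d * euclid R d => (v i)%:E * (eigencoord i z.2 ^+ 2)%:E)%E.
  apply/measurable_funeM/measurable_EFinP/measurable_funX.
  by apply: (measurableT_comp (measurable_eigencoord i)); exact: measurable_snd.
have me i : measurable_fun setT (fun z => (eigencoord i z ^+ 2)%:E).
  by apply/measurable_EFinP/measurable_funX; exact: measurable_eigencoord.
have ge1 i (z : euclid R d) : (0 <= (u i)%:E * (eigencoord i z ^+ 2)%:E)%E.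
  by rewrite -EFinM lee_fin mulr_ge0// sqr_ge0.
have ge2 i (z : euclid R d) : (0 <= (v i)%:E * (eigencoord i z ^+ 2)%:E)%E.
  by rewrite -EFinM lee_fin mulr_ge0// sqr_ge0.
apply: (@le_trans _ _ (\int[p]_z
   ((sqdist (affine_vec 0 (P *m diag_mx a *m P^T) z.1)
            (affine_vec 0 (P *m diag_mx b *m P^T) z.2))%:E
    + (\sum_i (u i)%:E * (eigencoord i z.1 ^+ 2)%:E
       + \sum_i (v i)%:E * (eigencoord i z.2 ^+ 2)%:E)))%E).
  apply: ge0_le_integral => //.
  - by move=> z _; rewrite lee_fin sqdist_ge0.
  - exact/measurable_EFinP.
  - apply: emeasurable_funD; first exact/measurable_EFinP.
    by apply: emeasurable_funD; exact: emeasurable_sum.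
  - move=> z _; rewrite !sqdist_affine -!sumEFin -!big_split/=.
    by apply: lee_sum => i _; rewrite -!EFinM -!EFinD lee_fin addrA le_uv.
rewrite ge0_integralD//; last 4 first.
- by move=> z _; rewrite lee_fin sqdist_ge0.
- exact/measurable_EFinP.
- by move=> z _; rewrite adde_ge0// sume_ge0.
- by apply: emeasurable_funD; exact: emeasurable_sum.
apply: leeD2l.
rewrite ge0_integralD//; last 4 first.
- by move=> z _; rewrite sume_ge0.
- exact: emeasurable_sum.
- by move=> z _; rewrite sume_ge0.
- exact: emeasurable_sum.
rewrite !ge0_integral_sum// [X in (_ <= X%:E)%E]big_split /= EFinD; apply: leeD.
- rewrite -sumEFin; apply: lee_sum => i _.
  rewrite (integral_coupling_fst
    (F := fun x => (u i)%:E * (eigencoord i x ^+ 2)%:E)%E cp).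
    rewrite ge0_integralZl//.
    + by rewrite -[leRHS]mule1 lee_wpmul2l ?lee_fin ?std_gaussian_eigencoord.
    + by move=> z _; rewrite lee_fin sqr_ge0.
    + by rewrite lee_fin.
  exact: measurable_funeM.
- rewrite -sumEFin; apply: lee_sum => i _.
  rewrite (integral_coupling_snd
    (F := fun x => (v i)%:E * (eigencoord i x ^+ 2)%:E)%E cp).
    rewrite ge0_integralZl//.
    + by rewrite -[leRHS]mule1 lee_wpmul2l ?lee_fin ?std_gaussian_eigencoord.
    + by move=> z _; rewrite lee_fin sqr_ge0.
    + by rewrite lee_fin.
  exact: measurable_funeM.
Qed.

(** For finite [y] and [z] the left side is the mean of [x - y] and [x - z]; otherwise it is [-oo]
    under the two assumptions. *)
Lemma sub_half_le (x y z : \bar R) (r : R) :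
  (x <= y + r%:E)%E -> (x <= z + r%:E)%E ->
  (x - (2^-1)%:E * y - (2^-1)%:E * z <= r%:E)%E.
Proof.
have h20 : (0 < (2^-1 : R)%:E)%E by rewrite lte_fin invr_gt0.
move: y z => [y| |] [z| |]; rewrite ?gt0_muley ?gt0_muleNy//=; case: x => [x| |];
  rewrite ?addeNy ?addNye ?leNye//=.
by rewrite !lee_fin; lra.
Qed.

Lemma sinkhorn_gaussian_le (S T : 'M[R]_d) a b :
  sqrtmx S = P *m diag_mx a *m P^T -> sqrtmx T = P *m diag_mx b *m P^T ->
  (forall i, 0 <= a 0 i) -> (forall i, 0 <= b 0 i) ->
  (sinkhorn_div eps (gaussian 0%R S) (gaussian 0%R T) <=
   (\sum_i (2 * `|a 0 i ^+ 2 - b 0 i ^+ 2|))%:E)%E.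
Proof.
move=> SE TE a0 b0; apply: sub_half_le.
(* From the self-cost of the first measure it is the second variable that is rescaled, so the scalar
   inequality is applied to [(y, x)] and its weights are exchanged. *)
- pose uv i := cid (sqr_scale_diff_le (b0 i) (a0 i)).
  have uvP i := svalP (uv i).
  apply: le_trans (OT_gaussian_le (u := fun i => (sval (uv i)).2)
    (v := fun i => (sval (uv i)).1) SE SE SE TE _ _ _) _.
  + by move=> i; have [] := uvP i.
  + by move=> i; have [] := uvP i.
  + by move=> i x y; have [_ _ _ /(_ y x)] := uvP i; lra.
  + apply: leeD2l; rewrite lee_fin; apply: ler_sum => i _.
    by have [_ _ h _] := uvP i; rewrite addrC (le_trans h)// distrC.
- pose uv i := cid (sqr_scale_diff_le (a0 i) (b0 i)).
  have uvP i := svalP (uv i).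
  apply: le_trans (OT_gaussian_le (u := fun i => (sval (uv i)).1)
    (v := fun i => (sval (uv i)).2) TE TE SE TE _ _ _) _.
  + by move=> i; have [] := uvP i.
  + by move=> i; have [] := uvP i.
  + by move=> i x y; have [_ _ _ /(_ x y)] := uvP i; lra.
  + apply: leeD2l; rewrite lee_fin; apply: ler_sum => i _.
    by have [_ _ + _] := uvP i.
Qed.

End gaussian_sinkhorn.

Unset Implicit Arguments.

Theorem proposition4p5 (R : realType) (d : nat) (eps : R)
    (Sigma0 Sigmas P : 'M[R]_d) (l0 ls : 'rV[R]_d) (Sigma : R -> 'M[R]_d)
    (d_ge1 : (1 <= d)%N) (eps_gt0 : 0 < eps)
    (psd0 : psdmx Sigma0) (psds : psdmx Sigmas)
    (comm : Sigma0 *m Sigmas = Sigmas *m Sigma0)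
    (Porth : P *m P^T = 1%:M)
    (Sigma0E : Sigma0 = P *m diag_mx l0 *m P^T)
    (SigmasE : Sigmas = P *m diag_mx ls *m P^T)
    (flow : is_Gflow eps Sigmas Sigma0 Sigma) :
  let te := eps / 4 in
  exists lam : R -> 'rV[R]_d,
    [/\ forall t, 0 <= t -> Sigma t = P *m diag_mx (lam t) *m P^T,
        forall i, lam 0 0 i = l0 0 i /\
          {ae lebesgue_measure, forall t : R, 0 <= t ->
             is_derive t (1 : R) (fun s => lam s 0 i)
               (4 * lam t 0 i *
                (ls 0 i / (Num.sqrt (ls 0 i * lam t 0 i + te ^+ 2) + te)
                 - lam t 0 i / (Num.sqrt (lam t 0 i ^+ 2 + te ^+ 2) + te)))},
        forall i t, 0 <= t -> 0 < ls 0 i ->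
          `|lam t 0 i - ls 0 i|
            <= expR (- (rate_a eps (l0 0 i) (ls 0 i) * t))
               * `|l0 0 i - ls 0 i|,
        forall i t, 0 <= t -> ls 0 i = 0 ->
          `|lam t 0 i - ls 0 i| = lam t 0 i /\
          lam t 0 i <= l0 0 i / (1 + l0 0 i * rate_b eps (l0 0 i) * t)
      & forall t, 0 <= t ->
          (sinkhorn_div eps (gaussian 0 (Sigma t)) (gaussian 0 Sigmas)
           <= (\sum_(i < d | (0 < ls 0 i)%R)
                 lip_const eps (ls 0 i)
                 * expR (- (rate_a eps (l0 0 i) (ls 0 i) * t))
                 * `|l0 0 i - ls 0 i|
               + \sum_(i < d | ls 0 i == 0%R)
                 lip_const eps (ls 0 i)
                 * (l0 0 i / (1 + l0 0 i * rate_b eps (l0 0 i) * t)))%:E)%E].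
Proof.
move=> te; have PtP : P^T *m P = 1%:M by exact: mulmx1C.
have [Sigma_0 Sigma_cont Sigma_psd Sigma_flow] := flow.
have unconj (X : 'M[R]_d) : P^T *m (P *m X *m P^T) *m P = X.
  by rewrite !mulmxA PtP mul1mx -mulmxA PtP mulmx1.
have diag_ge0 (a : 'rV[R]_d) : psdmx (P *m diag_mx a *m P^T) ->
    forall i, 0 <= a 0 i.
  move=> /(psdmx_congr P); rewrite unconj => apsd i.
  by have := psdmx_diag_ge0 i apsd; rewrite mxE eqxx mulr1n.
have ls0 : forall i, 0 <= ls 0 i by apply: diag_ge0; rewrite -SigmasE.
pose M t := P^T *m Sigma t *m P.
have SigmaM t : Sigma t = P *m M t *m P^T.
  by rewrite /M !mulmxA Porth mul1mx -mulmxA Porth mulmx1.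
have M_psd (t : R) : 0 <= t -> psdmx (M t).
  by move=> t0; exact/psdmx_congr/Sigma_psd.
have M_cont i j : {within `[0, +oo[, continuous (fun s => M s i j)}.
  exact: within_continuous_mulmx3.
have M_flow (t : R) i j : 0 < t -> is_derive t (1 : R) (fun s => M s i j)
    (flow_field eps (diag_mx ls) (M t) i j).
  move=> t0; have Mt := M_psd t (ltW t0).
  have -> : flow_field eps (diag_mx ls) (M t) =
      P^T *m flow_field eps Sigmas (Sigma t) *m P.
    rewrite /flow_field SigmasE (SigmaM t) Gmx_conjmx//; last exact: psdmx_diag_mx.
    set G := Gmx _ _ _; set X := LHS.
    rewrite (conjmx_mul _ _ PtP) (conjmx_mul _ _ PtP) -mulmxDl -mulmxDr.
    by rewrite -mulNmx -mulmxN unconj.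
  exact: is_derive_mulmx3 (Sigma_flow t t0).
have M0 : M 0 = diag_mx l0 by rewrite /M Sigma_0 Sigma0E unconj.
have M0d : M 0 = diagpart (M 0).
  by rewrite M0; congr diag_mx; apply/rowP => i; rewrite !mxE eqxx mulr1n.
pose lam t : 'rV[R]_d := \row_i M t i i.
have lam0 i : lam 0 0 i = l0 0 i by rewrite mxE M0 mxE eqxx mulr1n.
have lam_ge0 i (t : R) : 0 <= t -> 0 <= lam t 0 i.
  by move=> t0; rewrite mxE; exact/psdmx_diag_ge0/M_psd.
have lamE i : (fun s => lam s 0 i) = (fun s => M s i i).
  by apply/funext => s; rewrite mxE.
have lam_cont i : {within `[0, +oo[, continuous (fun s => lam s 0 i)}.
  by rewrite lamE; exact: M_cont.
have lam_flow i (t : R) : 0 < t -> is_derive t (1 : R) (fun s => lam s 0 i)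
    (eigen_field eps (ls 0 i) (lam t 0 i)).
  move=> t0; rewrite lamE mxE.
  exact: (flow_eigenvalue eps_gt0 ls0 M_psd M_cont M_flow i t0 M0d).
have lam_a i (t : R) : 0 <= t -> `|lam t 0 i - ls 0 i| <=
    expR (- (rate_a eps (l0 0 i) (ls 0 i) * t)) * `|l0 0 i - ls 0 i|.
  move=> t0; have := lam_exp_decay eps_gt0 (ls0 i) (lam_ge0 i) (lam_cont i)
    (lam_flow i) t0.
  by rewrite lam0.
have lam_b i (t : R) : 0 <= t -> ls 0 i = 0 ->
    lam t 0 i <= l0 0 i / (1 + l0 0 i * rate_b eps (l0 0 i) * t).
  move=> t0 lsi; have := lam_hyperbolic_decay eps_gt0 (ls0 i) (lam_ge0 i)
    (lam_cont i) (lam_flow i) lsi t0.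
  by rewrite lam0.
have SigmaE t : 0 <= t -> Sigma t = P *m diag_mx (lam t) *m P^T.
  move=> t0; rewrite SigmaM.
  by rewrite {1}(flow_offdiag_eq0 eps_gt0 ls0 M_psd M_cont M_flow t0 M0d).
exists lam; split => //.
- move=> i; split=> //.
  (* The exceptional set is the endpoint 0, where the flow is only assumed continuous. *)
  exists [set 0]; split => //; first exact: lebesgue_measure_set1.
  move=> t /= nt; apply/eqP; apply: contra_notT nt => t0' t0.
  by apply: lam_flow; rewrite lt_def t0'.
- by move=> i t t0 _; exact: lam_a.
- move=> i t t0 lsi; split; last exact: lam_b.
  by rewrite lsi subr0 ger0_norm// lam_ge0.
move=> t t0.
have sqrtE (S : 'M[R]_d) (a : 'rV[R]_d) : S = P *m diag_mx a *m P^T ->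
    (forall i, 0 <= a 0 i) ->
    sqrtmx S = P *m diag_mx (\row_i Num.sqrt (a 0 i)) *m P^T.
  by move=> -> a0; exact: sqrtmx_conj_diag.
have sqrE (a : 'rV[R]_d) i : 0 <= a 0 i ->
    (\row_k Num.sqrt (a 0 k)) 0 i ^+ 2 = a 0 i.
  by move=> ai0; rewrite mxE sqr_sqrtr.
have := sinkhorn_gaussian_le PtP eps_gt0
  (sqrtE _ _ (SigmaE t t0) (fun i => lam_ge0 i t t0)) (sqrtE _ _ SigmasE ls0).
move=> /(_ _ _)/le_trans; apply.
- by move=> i; rewrite mxE sqrtr_ge0.
- by move=> i; rewrite mxE sqrtr_ge0.
(* The factor 2 is at most [lip_const] when the target eigenvalue is positive, and equal to it when
   that eigenvalue is zero. *)
rewrite lee_fin (bigID (fun i => 0 < ls 0 i))/=; apply: lerD.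
- apply: ler_sum => i lsi; rewrite !sqrE ?lam_ge0// -mulrA.
  apply: ler_pM => //; last exact: lam_a.
  by rewrite /lip_const ler_peMr// lerDl !divr_ge0// ltW.
- rewrite (eq_bigl (fun i => ls 0 i == 0)); last first.
    by move=> i; rewrite -leNgt eq_le ls0 andbT.
  apply: ler_sum => i /eqP lsi; rewrite !sqrE ?lam_ge0//.
  rewrite lsi subr0 ger0_norm ?lam_ge0// /lip_const mul0r addr0 mulr1.
  by rewrite ler_wpM2l// lam_b.
Qed.
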